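(* Let $d\ge2$, $\alpha>d/2$ and $\beta\in\mathbb{R}$. There is a constant $c>0$ independent of $n$ such that for all $n\ge2$, $$e_n\big(\mathrm{H}^{\alpha,\beta}(\mathbb{S}^d)\big)\ge c\, n^{-\alpha/d}(\ln n)^{-\beta}.$$
   Context: Let $d\ge2$, let $\mathbb{S}^d$ be the unit sphere in $\mathbb{R}^{d+1}$, and let $\sigma_d$ be its normalized surface measure ($\sigma_d(\mathbb{S}^d)=1$). Let $L_2=L_2(\mathbb{S}^d,\sigma_d)$. Let $H_\ell(f)$ be the $L_2$-orthogonal projection of $f$ onto the space $\mathcal{H}^d_\ell$ of spherical harmonics of degree $\ell$. For $\alpha>0$ and $\beta\in\mathbb{R}$ let $\lambda^{(\alpha,\beta)}_\ell=(1+\ell(\ell+d-1))^{-\alpha/2}(\ln(3+\ell(\ell+d-1)))^{-\beta}$. Define $$\mathrm{H}^{\alpha,\beta}(\mathbb{S}^d)=\Big\{f\in L_2:\ \|f\|^2_{\mathrm{H}^{\alpha,\beta}}=\sum_{\ell\ge0}(\lambda^{(\alpha,\beta)}_\ell)^{-2}\|H_\ell(f)\|_{L_2}^2<\infty\Big\}.$$ For $\alpha>d/2$ this is a reproducing kernel Hilbert space of continuous functions. For such a space $H$, the $n$-th optimal quadrature error is $$e_n(H)=\inf_{c\in\mathbb{R}^n,\ x_1,\dots,x_n\in\mathbb{S}^d}\ \sup_{\|f\|_H\le1}\Big|\int_{\mathbb{S}^d}f\,d\sigma_d-\sum_{j=1}^n c_jf(x_j)\Big|.$$ *)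

(* Defs.v *)
From HB Require Import structures.
From mathcomp Require Import all_boot all_order all_algebra.
From mathcomp Require Import all_classical all_reals all_analysis.
Unset Implicit Arguments. Unset Strict Implicit. Unset Printing Implicit Defensive.
Import Order.TTheory GRing.Theory Num.Theory.
Import numFieldNormedType.Exports.
Local Open Scope classical_set_scope.
Local Open Scope ring_scope.

Section Sphere.
Variable R : realType.

Definition sqnorm m (x : 'rV[R]_m) : R := \sum_(i < m) (x ord0 i) ^+ 2.
Definition enorm m (x : 'rV[R]_m) : R := Num.sqrt (sqnorm m x).

Definition sphere d : set 'rV[R]_(d.+1) := [set x | sqnorm d.+1 x = 1].

(** Iterated Lebesgue integral over R^m of a function of the coordinates
    (given as a list x_1 :: ... :: x_m).  For nonnegative measurable
    integrands this is the Lebesgue integral over R^m (Tonelli). *)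
Fixpoint iint (m : nat) (F : seq R -> \bar R) : \bar R :=
  match m with
  | 0 => F [::]
  | m'.+1 => (\int[@lebesgue_measure R]_x iint m' (fun s => F (x :: s)))%E
  end.

Definition vec_of_seq m (s : seq R) : 'rV[R]_m := \row_(i < m) nth 0 s i.

Definition gauss m (v : 'rV[R]_m) : R := expR (- sqnorm m v / 2).

(** Integral of a nonnegative function g over S^d against the normalized
    surface measure sigma_d, defined through the rotation invariance of the
    Gaussian:  int_{S^d} g dsigma_d
      = (int_{R^{d+1}} g(v/|v|) gauss(v) dv) / (int_{R^{d+1}} gauss(v) dv). *)
Definition sph_int_nn d (g : 'rV[R]_(d.+1) -> R) : \bar R :=
  (iint d.+1 (fun s => (g ((enorm d.+1 (vec_of_seq d.+1 s))^-1 *: vec_of_seq d.+1 s)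
                         * gauss d.+1 (vec_of_seq d.+1 s))%:E)
   * ((fine (iint d.+1 (fun s => (gauss d.+1 (vec_of_seq d.+1 s))%:E)))^-1)%:E)%E.

Definition sph_int d (f : 'rV[R]_(d.+1) -> R) : R :=
  fine (sph_int_nn d (fun x => Num.max (f x) 0))
  - fine (sph_int_nn d (fun x => Num.max (- f x) 0)).

Definition l2dot d (f g : 'rV[R]_(d.+1) -> R) : R := sph_int d (fun x => f x * g x).
Definition l2sqnorm d (f : 'rV[R]_(d.+1) -> R) : R := l2dot d f f.

Definition monomial m (e : 'I_m -> nat) (x : 'rV[R]_m) : R :=
  \prod_(i < m) (x ord0 i) ^+ (e i).

Definition homog_poly m (l : nat) (P : 'rV[R]_m -> R) : Prop :=
  exists s : seq (('I_m -> nat) * R),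
    (forall t, t \in s -> (\sum_(i < m) t.1 i)%N = l) /\
    forall x, P x = \sum_(t <- s) t.2 * monomial m t.1 x.

Definition unitvec m (i : 'I_m) : 'rV[R]_m := \row_(j < m) (i == j)%:R.
Definition laplacian m (P : 'rV[R]_m -> R) (x : 'rV[R]_m) : R :=
  \sum_(i < m) 'D_(unitvec m i) (fun y => 'D_(unitvec m i) P y) x.

(** H^d_l : spherical harmonics of degree l (restrictions to S^d of
    homogeneous harmonic polynomials of degree l; we keep the polynomial
    function on R^(d+1), only its values on S^d matter below). *)
Definition sph_harm d (l : nat) : set ('rV[R]_(d.+1) -> R) :=
  [set Y | homog_poly d.+1 l Y /\ forall x, laplacian d.+1 Y x = 0].

Definition is_proj d (l : nat) (f g : 'rV[R]_(d.+1) -> R) : Prop :=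
  sph_harm d l g /\ forall Y, sph_harm d l Y -> l2dot d (f \- g) Y = 0.

(** H_l(f) (the projection exists and is unique; we pick it by choice). *)
Definition projH d (l : nat) (f : 'rV[R]_(d.+1) -> R) : 'rV[R]_(d.+1) -> R :=
  xget (fun _ => 0) [set g | is_proj d l f g].

Definition lam d (alpha beta : R) (l : nat) : R :=
  (1 + (l * (l + d - 1))%:R) `^ (- alpha / 2)
  * (ln (3 + (l * (l + d - 1))%:R)) `^ (- beta).

Definition Hnorm2 d (alpha beta : R) (f : 'rV[R]_(d.+1) -> R) : \bar R :=
  (\sum_(0 <= l <oo) ((lam d alpha beta l) ^- 2 * l2sqnorm d (projH d l f))%:E)%E.

(** Unit ball of H^{alpha,beta}(S^d).  For alpha > d/2 every element has a
    (unique) continuous representative, and function values are those of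
    this representative; hence the unit ball consists of the functions
    continuous on S^d with squared norm <= 1. *)
Definition Hball d (alpha beta : R) : set ('rV[R]_(d.+1) -> R) :=
  [set f | {within sphere d, continuous f} /\ (Hnorm2 d alpha beta f <= 1)%E].

Definition wce d (alpha beta : R) n (c : 'I_n -> R) (x : 'I_n -> 'rV[R]_(d.+1))
  : \bar R :=
  ereal_sup [set (`| sph_int d f - \sum_(j < n) c j * f (x j) |)%:E
             | f in Hball d alpha beta].

Definition e_n d (alpha beta : R) (n : nat) : \bar R :=
  ereal_inf [set wce d alpha beta n cx.1 cx.2
             | cx in [set cx : ('I_n -> R) * ('I_n -> 'rV[R]_(d.+1))
                      | forall j, sphere d (cx.2 j)]].

End Sphere.

(* Main.v *)
(** Let [M(x,y) = ((1 + <x,y>) / 2)^L] with [L] even and of order [n^(2/d)]; its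
    feature functions are words in the letters [1, x_0, ..., x_d].  For a
    quadrature rule with error functional [phi], the fooling function is a
    multiple of [y |-> phi(M(.,y))], for which [phi] takes the value
    [E = m0 - 2 m0 s + sum c_j c_k M(x_j,x_k)] with [m0 = int M(x,y) dy] and
    [s = sum c_j].  Since [M] is the square of a positive semidefinite kernel with
    unit diagonal, Vybiral's inequality bounds the double sum below by [s^2 / n],
    so [E >= m0 - n m0^2 >= m0 / 2] as soon as [n m0 <= 1/2].

    The norm is controlled by the eigenvalues of [M].  The Laplace-Beltrami
    operator is symmetric because the integral is invariant under rotations, and it
    maps [M_L] to a combination of [M_L] and [M_(L-1)].  Hence on harmonics of
    degree [l], with [mu_l = l (l + d - 1)], the eigenvalue quotients
    [r_l(L) = b_l(L) / m0(L)] obey [r_l(L) = (1 - mu_l / mu_(L+1)) r_l(L+1)];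
    they tend to [1] as [L] grows, whence
    [0 <= r_l(L) <= exp(- mu_l / (2 (L + d)))].  This decay beats the weights
    [lambda_l^-2] for degrees beyond [n^(1/d)], and a Bessel inequality in the
    space of the kernel bounds the norm of the fooling function by
    [E * max_l (lambda_l^-2 b_l)]. *)

Require Import Defs.
From HB Require Import structures.
From mathcomp Require Import all_boot all_order all_algebra.
From mathcomp Require Import all_classical all_reals all_analysis.
From mathcomp Require Import measurable_realfun ring lra zify.
Import Order.TTheory GRing.Theory Num.Theory.
Import numFieldNormedType.Exports.
Local Open Scope classical_set_scope.
Local Open Scope ring_scope.
Set Implicit Arguments.
Unset Strict Implicit.
Unset Printing Implicit Defensive.

(** * Iterated Lebesgue integrals *)

(** The orders of magnitude come from two decay rates. Since [m0(L)] decays like [L^(-d/2)], the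
    condition [n m0 <= 1/2] is met with [L] of order [n^(2/d)]. The quotient [r_l] decays like a
    Gaussian in [l / sqrt L], so the kernel essentially lives on degrees up to [n^(1/d)], where
    [lambda_l^-2] is of the order of the inverse square of the claimed rate. After normalization the
    squared error is at least [E / (m0 * max_l (lambda_l^-2 r_l))]; as [E >= m0 / 2], the factor
    [m0] cancels.

    The norm is defined through projections onto harmonics, which makes localized bumps avoiding the
    nodes awkward; a polynomial with computable components is used instead, and positivity replaces
    vanishing at the nodes. The surface measure is given by iterated integrals of a Gaussian, so its
    rotation invariance has to be derived from one-dimensional translations and Tonelli's theorem.
    The passage from rotations to differential operators is made on polynomial expressions, where
    every error term can be bounded by structural induction. *)

(* Measurability of the uncurried map [T * R^m -> V]; the parameter space [T]
   absorbs the integration variables one at a time, so that no [m]-fold product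
   of measurable types has to be formed. *)
Fixpoint imeas (R : realType) dV (V : measurableType dV) (m : nat)
    d (T : measurableType d) (F : T -> seq R -> V) : Prop :=
  match m with
  | 0 => measurable_fun setT (fun t => F t [::])
  | m'.+1 => @imeas R dV V m' _ (T * R)%type
               (fun p s => F p.1 (p.2 :: s))
  end.
Arguments imeas {R dV V} m {d T} F.

Lemma imeas_comp (R : realType) dV (V : measurableType dV) dW
    (W : measurableType dW) (phi : V -> W) m d (T : measurableType d)
    (F : T -> seq R -> V) :
  measurable_fun setT phi -> imeas m F -> imeas m (fun t s => phi (F t s)).
Proof.
move=> mphi; elim: m d T F => [|m IHm] d T F /= mF.
  exact: (measurableT_comp mphi mF).
exact: IHm mF.
Qed.

Lemma imeas_param (R : realType) dV (V : measurableType dV) m d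
    (T : measurableType d) (f : T -> V) :
  measurable_fun setT f -> imeas m (fun t (_ : seq R) => f t).
Proof.
elim: m d T f => [|m IHm] d T f //= mf.
apply: (IHm _ _ (fun p : T * R => f p.1)).
exact: (measurableT_comp mf measurable_fst).
Qed.

Lemma imeas_nth (R : realType) m d (T : measurableType d) i :
  imeas m (fun (t : T) s => nth (0 : R) s i).
Proof.
elim: m i d T => [|m IHm] i d T /=; first exact: measurable_cst.
case: i => [|i] /=; last exact: IHm.
apply: (@imeas_param R _ _ m _ _ (fun p : T * R => p.2)).
exact: measurable_snd.
Qed.

Lemma imeasD (R : realType) m d (T : measurableType d) (F G : T -> seq R -> R) :
  imeas m F -> imeas m G -> imeas m (fun t s => F t s + G t s).
Proof.
elim: m d T F G => [|m IHm] d T F G /= mF mG.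
  exact: measurable_funD.
exact: IHm.
Qed.

Lemma imeasM (R : realType) m d (T : measurableType d) (F G : T -> seq R -> R) :
  imeas m F -> imeas m G -> imeas m (fun t s => F t s * G t s).
Proof.
elim: m d T F G => [|m IHm] d T F G /= mF mG.
  exact: measurable_funM.
exact: IHm.
Qed.

Lemma imeas_sum (R : realType) m d (T : measurableType d) (I : Type) (r : seq I)
    (F : I -> T -> seq R -> R) :
  (forall i, imeas m (F i)) -> imeas m (fun t s => \sum_(i <- r) F i t s).
Proof.
move=> mF; elim: r => [|i r IH].
  under [X in imeas m X]eq_fun => t do under eq_fun => s do rewrite big_nil.
  exact: imeas_param.
under [X in imeas m X]eq_fun => t do under eq_fun => s do rewrite big_cons.
exact: imeasD.
Qed.

Lemma iint_ge0 (R : realType) m (F : seq R -> \bar R) :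
  (forall s, (0 <= F s)%E) -> (0 <= iint R m F)%E.
Proof.
elim: m F => [|m IHm] F F0 //=.
by apply: integral_ge0 => x _; exact: IHm.
Qed.

Lemma imeas_iint (R : realType) m d (T : measurableType d)
    (F : T -> seq R -> \bar R) :
  (forall t s, (0 <= F t s)%E) -> imeas m F ->
  measurable_fun setT (fun t => iint R m (F t)).
Proof.
elim: m d T F => [|m IHm] d T F F0 //= mF.
have := measurable_fun_fubini_tonelli_F (m2 := @lebesgue_measure R)
  (fun p : T * R => iint R m (fun s => F p.1 (p.2 :: s))).
apply.
  exact: (IHm _ _ (fun p s => F p.1 (p.2 :: s))).
by move=> p; exact: iint_ge0.
Qed.

Lemma eq_iint (R : realType) m (F G : seq R -> \bar R) :
  (forall s, size s = m -> F s = G s) -> iint R m F = iint R m G.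
Proof.
elim: m F G => [|m IHm] F G FG /=; first exact: FG.
by apply: eq_integral => x _; apply: IHm => s ss; apply: FG; rewrite /= ss.
Qed.

Lemma imeas_iint_section (R : realType) m d (T : measurableType d)
    (F : T -> seq R -> \bar R) t :
  (forall t s, (0 <= F t s)%E) -> imeas m.+1 F ->
  measurable_fun setT (fun x : R => iint R m (fun s => F t (x :: s))).
Proof.
move=> F0 mF.
have mI := imeas_iint (F := fun (p : T * R) s => F p.1 (p.2 :: s))
  (fun p s => F0 _ _) mF.
exact: (measurableT_comp mI (pair1_measurable t)).
Qed.

Lemma iintD (R : realType) m d (T : measurableType d)
    (F G : T -> seq R -> \bar R) t :
  (forall t s, (0 <= F t s)%E) -> (forall t s, (0 <= G t s)%E) ->
  imeas m F -> imeas m G ->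
  iint R m (fun s => F t s + G t s)%E = (iint R m (F t) + iint R m (G t))%E.
Proof.
elim: m d T F G t => [|m IHm] d T F G t F0 G0 mF mG //=.
rewrite -ge0_integralD//; first last.
- exact: (imeas_iint_section _ G0).
- by move=> x _; exact: iint_ge0.
- exact: (imeas_iint_section _ F0).
- by move=> x _; exact: iint_ge0.
apply: eq_integral => x _.
exact: (IHm _ _ (fun (p : T * R) s => F p.1 (p.2 :: s))
  (fun (p : T * R) s => G p.1 (p.2 :: s)) (t, x)).
Qed.

Lemma iintZ (R : realType) m d (T : measurableType d)
    (F : T -> seq R -> \bar R) t (k : R) :
  0 <= k -> (forall t s, (0 <= F t s)%E) -> imeas m F ->
  iint R m (fun s => k%:E * F t s)%E = (k%:E * iint R m (F t))%E.
Proof.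
move=> k0; elim: m d T F t => [|m IHm] d T F t F0 mF //=.
rewrite -ge0_integralZl//; first last.
- by move=> x _; exact: iint_ge0.
- exact: (imeas_iint_section _ F0).
apply: eq_integral => x _.
exact: (IHm _ _ (fun (p : T * R) s => F p.1 (p.2 :: s)) (t, x)).
Qed.

Lemma le_iint (R : realType) m d (T : measurableType d)
    (F G : T -> seq R -> \bar R) t :
  (forall t s, (0 <= F t s)%E) -> (forall t s, (F t s <= G t s)%E) ->
  imeas m F -> imeas m G -> (iint R m (F t) <= iint R m (G t))%E.
Proof.
elim: m d T F G t => [|m IHm] d T F G t F0 FG mF mG //=.
have G0 t' s : (0 <= G t' s)%E by exact: le_trans (F0 _ _) (FG _ _).
apply: ge0_le_integral => //.
- by move=> x _; exact: iint_ge0.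
- exact: (imeas_iint_section _ F0).
- exact: (imeas_iint_section _ G0).
- move=> x _; exact: (IHm _ _ (fun (p : T * R) s => F p.1 (p.2 :: s))
  (fun (p : T * R) s => G p.1 (p.2 :: s)) (t, x)).
Qed.

(* The first coordinate vanishes only on a null set. *)
Lemma eq_iint_neq0 (R : realType) m d (T : measurableType d)
    (F G : T -> seq R -> \bar R) t :
  (forall t s, (0 <= F t s)%E) -> (forall t s, (0 <= G t s)%E) ->
  imeas m.+1 F -> imeas m.+1 G ->
  (forall x s, x != 0 -> size s = m -> F t (x :: s) = G t (x :: s)) ->
  iint R m.+1 (F t) = iint R m.+1 (G t).
Proof.
move=> F0 G0 mF mG FG /=.
have split0 (H : T -> seq R -> \bar R) : (forall t s, (0 <= H t s)%E) ->
    imeas m.+1 H ->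
    (\int[@lebesgue_measure R]_x iint R m (fun s => H t (x :: s)) =
     \int[@lebesgue_measure R]_(x in ~` [set 0%R : R])
        iint R m (fun s => H t (x :: s)))%E.
  move=> H0 mH.
  rewrite -[in LHS](setUv [set (0 : R)]) ge0_integral_setU//=.
  - by rewrite integral_set1 add0e.
  - exact: measurableC.
  - rewrite setUv; exact: (imeas_iint_section _ H0).
  - by move=> x _; exact: iint_ge0.
  - exact/disj_setPCl.
rewrite !split0//; apply: eq_integral => x; rewrite inE/= => /eqP x0.
by apply: eq_iint => s ss; exact: FG.
Qed.

Lemma lebesgue_measureD (R : realType) (a : R) (A : set (measurableTypeR R)) :
  measurable A ->
  lebesgue_measure A = pushforward (@lebesgue_measure R) (fun x : R => x + a) A.
Proof.
have mD : measurable_fun [set: measurableTypeR R] (fun x : R => x + a : measurableTypeR R).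
  exact: measurable_funD.
pose nu0 : {measure set (measurableTypeR R) -> \bar R} :=
  pushforward (@lebesgue_measure R) (fun x : measurableTypeR R => x + a : measurableTypeR R).
move=> mA; pose nu := nu0 mD.
suff nuE : forall X, ocitv X -> lebesgue_measure X = nu X.
  exact: (lebesgue_measure_unique nuE mA).
move=> X [[u v] /= uv <-].
rewrite /nu /nu0 /pushforward /=.
have -> : (fun x : R => x + a) @^-1` `]u, v] = `]u - a, v - a]%classic.
  by apply/seteqP; split=> x /=; rewrite !in_itv/= ltrBlDr lerBrDr.
rewrite !lebesgue_measure_itv/= !lte_fin ltrD2r.
by case: ifP => // _; rewrite !EFinB; congr (_%:E); ring.
Qed.

Lemma ge0_integral_shift (R : realType) (a : R) (f : R -> \bar R) :
  measurable_fun setT f -> (forall x, (0 <= f x)%E) ->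
  (\int[@lebesgue_measure R]_x f (x + a)%R = \int[@lebesgue_measure R]_x f x)%E.
Proof.
move=> mf f0.
have mD : measurable_fun [set: measurableTypeR R] (fun x : R => x + a : measurableTypeR R).
  exact: measurable_funD.
have := ge0_integral_pushforward mD (@lebesgue_measure R) measurableT mf
  (fun y _ => f0 y).
rewrite preimage_setT => <-.
apply: eq_measure_integral => A mA _.
by symmetry; apply: (lebesgue_measureD a mA).
Qed.

Lemma integral_shear (R : realType) (a : R) (H : R * R -> \bar R) :
  measurable_fun setT H -> (forall p, (0 <= H p)%E) ->
  (\int[@lebesgue_measure R]_x \int[@lebesgue_measure R]_y H (x, y + a * x)%R =
   \int[@lebesgue_measure R]_x \int[@lebesgue_measure R]_y H (x, y))%E.
Proof.
move=> mH H0; apply: eq_integral => x _.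
apply: (@ge0_integral_shift R (a * x) (fun y => H (x, y))) => //.
exact: (measurableT_comp mH (pair1_measurable x)).
Qed.

Lemma integral_swap (R : realType) (H : R * R -> \bar R) :
  measurable_fun setT H -> (forall p, (0 <= H p)%E) ->
  (\int[@lebesgue_measure R]_x \int[@lebesgue_measure R]_y H (x, y) =
   \int[@lebesgue_measure R]_x \int[@lebesgue_measure R]_y H (y, x))%E.
Proof. by move=> mH H0; rewrite fubini_tonelli. Qed.

(** Here [a] is the tangent of half the angle, so [c] and [s] are its cosine and sine, rational in
    [a]. The rotation factors into shears of slopes [-a], [s], [-a], and a shear only translates one
    variable. *)
Lemma integral_rotation (R : realType) (a : R) (H : R * R -> \bar R) :
  measurable_fun setT H -> (forall p, (0 <= H p)%E) ->
  let c := (1 - a ^+ 2) / (1 + a ^+ 2) in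
  let s := 2 * a / (1 + a ^+ 2) in
  (\int[@lebesgue_measure R]_x \int[@lebesgue_measure R]_y
     H (c * x - s * y, s * x + c * y)%R =
   \int[@lebesgue_measure R]_x \int[@lebesgue_measure R]_y H (x, y))%E.
Proof.
move=> mH H0 c s.
have a1 : 1 + a ^+ 2 != 0 by rewrite gt_eqF// ltr_pwDl// sqr_ge0.
have mcomp (f g : R * R -> R) (K : R * R -> \bar R) : measurable_fun setT K ->
    measurable_fun setT f -> measurable_fun setT g ->
    measurable_fun setT (fun p => K (f p, g p)).
  by move=> mK mf mg; apply: (measurableT_comp mK); exact: measurable_fun_pair.
have mlin (u v : R) : measurable_fun setT (fun p : R * R => u * p.1 + v * p.2).
  by apply: measurable_funD; apply: measurable_funM.
have mlin2 (u v u' v' : R) (K : R * R -> \bar R) : measurable_fun setT K ->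
    measurable_fun setT (fun p => K (u * p.1 + v * p.2, u' * p.1 + v' * p.2)).
  by move=> mK; exact: mcomp.
(* a rotation is a product of three shears: [H1], [H2], [H3] *)
pose H1 (p : R * R) := H (1 * p.1 + (- a) * p.2, 0 * p.1 + 1 * p.2).
pose H2 (p : R * R) := H1 (1 * p.1 + 0 * p.2, s * p.1 + 1 * p.2).
pose H3 (p : R * R) := H2 (1 * p.1 + (- a) * p.2, 0 * p.1 + 1 * p.2).
have mH1 : measurable_fun setT H1 by exact: mlin2.
have mH2 : measurable_fun setT H2 by exact: mlin2.
have mH3 : measurable_fun setT H3 by exact: mlin2.
(* Exchanging the order of integration turns a shear of the first variable into [integral_shear]. *)
have shear1 (K : R * R -> \bar R) : measurable_fun setT K ->
    (forall p, (0 <= K p)%E) ->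
  (\int[@lebesgue_measure R]_x \int[@lebesgue_measure R]_y
     K (1 * x + (- a) * y, 0 * x + 1 * y)%R =
   \int[@lebesgue_measure R]_x \int[@lebesgue_measure R]_y K (x, y))%E.
  move=> mK K0.
  have mL : measurable_fun setT
      (fun p : R * R => K (1 * p.1 + (- a) * p.2, 0 * p.1 + 1 * p.2)).
    exact: mlin2.
  apply: (etrans (integral_swap mL (fun p => K0 _))).
  apply: (etrans _ (esym (integral_swap mK K0))).
  have mK' : measurable_fun setT (fun p : R * R => K (p.2, p.1)).
    exact: mcomp.
  apply: (etrans _ (integral_shear (- a) mK' (fun p => K0 _))).
  apply: eq_integral => x _; apply: eq_integral => y _ /=.
  by congr K; congr pair; ring.
transitivity (\int[@lebesgue_measure R]_x \int[@lebesgue_measure R]_y H3 (x, y))%E.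
  apply: eq_integral => x _; apply: eq_integral => y _ /=.
  rewrite /H3 /H2 /H1 /=; congr H; congr pair.
    by rewrite /c /s; field.
  by rewrite /c /s; field.
transitivity (\int[@lebesgue_measure R]_x \int[@lebesgue_measure R]_y H2 (x, y))%E.
  exact: (shear1 H2 mH2 (fun p => H0 _)).
transitivity (\int[@lebesgue_measure R]_x \int[@lebesgue_measure R]_y H1 (x, y))%E.
  apply: (etrans _ (integral_shear s mH1 (fun p => H0 _))).
  apply: eq_integral => x _; apply: eq_integral => y _ /=.
  by rewrite /H2; congr H1; congr pair => /=; ring.
exact (shear1 H mH H0).
Qed.

(** Only neighbouring coordinates are rotated: once the outer variables have become parameters, the
    pair belongs to two consecutive integrals. *)
Fixpoint rotate_at (R : realType) (c s : R) (k : nat) (l : seq R) : seq R :=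
  match k, l with
  | 0, x :: y :: l' => (c * x - s * y) :: (s * x + c * y) :: l'
  | k'.+1, x :: l' => x :: rotate_at c s k' l'
  | _, _ => l
  end.

Lemma iint_rotate_at (R : realType) (a : R) k m d (T : measurableType d)
    (F : T -> seq R -> \bar R) t : (k.+1 < m)%N ->
  (forall t s, (0 <= F t s)%E) -> imeas m F ->
  let c := (1 - a ^+ 2) / (1 + a ^+ 2) in
  let s := 2 * a / (1 + a ^+ 2) in
  iint R m (fun l => F t (rotate_at c s k l)) = iint R m (F t).
Proof.
move=> km F0 mF c s.
elim: k m d T F t km F0 mF => [|k IHk] [|m] d T F t //= km F0 mF.
  case: m km mF => [|m] km mF; first by rewrite ltnn in km.
  pose H (p : R * R) := iint R m (fun l => F t (p.1 :: p.2 :: l)).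
  have mH : measurable_fun setT H.
    have mI := imeas_iint (F := fun (p : (T * R) * R) s => F p.1.1 (p.1.2 :: p.2 :: s))
      (fun p s => F0 _ _) mF.
    have mt : measurable_fun setT (fun p : R * R => ((t, p.1), p.2)).
      by apply: measurable_fun_pair => //; exact: measurable_fun_pair.
    exact: (measurableT_comp mI mt).
  have H0 p : (0 <= H p)%E by exact: iint_ge0.
  exact: (integral_rotation a mH H0).
apply: eq_integral => x _.
exact: (IHk m _ _ (fun (p : T * R) l => F p.1 (p.2 :: l)) (t, x)).
Qed.

(** * The surface integral as a positive functional *)

Lemma sqnorm_ge0 (R : realType) m (x : 'rV[R]_m) : 0 <= sqnorm R m x.
Proof. by apply: sumr_ge0 => i _; exact: sqr_ge0. Qed.

Lemma sqnorm_cons (R : realType) m (x : R) (s : seq R) :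
  sqnorm R m.+1 (vec_of_seq R m.+1 (x :: s)) =
  x ^+ 2 + sqnorm R m (vec_of_seq R m s).
Proof.
rewrite /sqnorm big_ord_recl !mxE /=; congr (_ + _).
by apply: eq_bigr => i _; rewrite !mxE.
Qed.

Lemma integral_gauss1 (R : realType) :
  (\int[@lebesgue_measure R]_x (expR (- x ^+ 2 / 2))%:E =
   ((normal_peak (1 : R))^-1)%:E)%E.
Proof.
have p0 : 0 < normal_peak (1 : R) by exact: normal_peak_gt0.
have := integral_normal_pdf (0 : R) 1.
rewrite normal_pdfE// => /(congr1 (fun z => ((normal_peak (1 : R))^-1)%:E * z)%E).
rewrite mule1 => <-.
rewrite -ge0_integralZl//.
- apply: eq_integral => x _; rewrite -EFinM mulrA mulVf ?gt_eqF// mul1r.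
  by rewrite /normal_fun subr0 expr1n.
- apply/measurable_EFinP; apply: measurable_funM => //.
  exact: measurable_normal_fun.
- by move=> x _; rewrite lee_fin mulr_ge0// ?normal_peak_ge0 ?normal_fun_ge0.
- by rewrite lee_fin invr_ge0 normal_peak_ge0.
Qed.

Lemma imeas_gauss (R : realType) m d (T : measurableType d) :
  imeas m (fun (_ : T) (s : seq R) => gauss R m (vec_of_seq R m s)).
Proof.
apply: (imeas_comp (phi := fun r : R => expR (- r / 2))).
  apply: measurableT_comp => //.
  by apply: measurable_funM => //; exact: measurable_funN.
apply: imeas_sum => i; under [X in imeas m X]eq_fun => t do
  under eq_fun => s do rewrite mxE expr2.
by apply: imeasM; exact: imeas_nth.
Qed.

Lemma iint_gauss (R : realType) m :
  iint R m (fun s => (gauss R m (vec_of_seq R m s))%:E) =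
  ((normal_peak (1 : R))^-1 ^+ m)%:E.
Proof.
elim: m => [|m IHm] /=.
  by rewrite expr0 /gauss /sqnorm big_ord0 oppr0 mul0r expR0.
have mG d (T : measurableType d) : imeas m (fun (_ : T) (s : seq R) =>
    (gauss R m (vec_of_seq R m s))%:E).
  apply: (imeas_comp (phi := EFin)); first exact/measurable_EFinP.
  exact: imeas_gauss.
transitivity (\int[@lebesgue_measure R]_x
   ((expR (- x ^+ 2 / 2))%:E * iint R m (fun s => (gauss R m (vec_of_seq R m s))%:E)))%E.
  apply: eq_integral => x _.
  rewrite -(iintZ (T := R) (F := fun _ s => (gauss R m (vec_of_seq R m s))%:E) 0)//.
  - by apply: eq_iint => s _; rewrite -EFinM /gauss sqnorm_cons -expRD; congr (expR _)%:E; lra.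
  - by move=> _ s; rewrite lee_fin expR_ge0.
rewrite IHm; under eq_integral => x _ do rewrite muleC.
rewrite ge0_integralZl//.
- by rewrite integral_gauss1 -EFinM -exprSr.
- apply/measurable_EFinP; apply: measurableT_comp => //.
  by apply: measurable_funM => //; apply: measurable_funN; exact: measurable_funX.
- by rewrite lee_fin exprn_ge0// invr_ge0 normal_peak_ge0.
Qed.

(* At the origin this is the zero vector, since [0^-1 = 0]. *)
Definition normalize (R : realType) m (s : seq R) : 'rV[R]_m :=
  (enorm R m (vec_of_seq R m s))^-1 *: vec_of_seq R m s.

(** The conditions concern only the points at which the surface integral evaluates [g]. They are
    stable under sums and products and make both parts of [sph_int] finite, so that [fine] loses
    nothing. *)
Definition bounded_imeas (R : realType) d (g : 'rV[R]_d.+1 -> R) : Prop :=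
  (exists C : R, forall s, `|g (normalize d.+1 s)| <= C) /\
  imeas d.+1 (fun (_ : unit) s => g (normalize d.+1 s)).

Lemma sqnormZ (R : realType) m (a : R) (x : 'rV[R]_m) :
  sqnorm R m (a *: x) = a ^+ 2 * sqnorm R m x.
Proof.
by rewrite /sqnorm mulr_sumr; apply: eq_bigr => i _; rewrite mxE exprMn.
Qed.

Lemma sphere_normalize (R : realType) d (x : R) (s : seq R) : x != 0 ->
  sphere R d (normalize d.+1 (x :: s)).
Proof.
move=> x0; rewrite /sphere /normalize /= sqnormZ /enorm exprVn sqr_sqrtr ?sqnorm_ge0//.
rewrite mulVf// sqnorm_cons gt_eqF// ltr_pwDl ?sqnorm_ge0//.
by rewrite exprn_even_gt0.
Qed.

Lemma sqnorm_normalize (R : realType) m (s : seq R) :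
  sqnorm R m (normalize m s) <= 1.
Proof.
rewrite /normalize sqnormZ /enorm exprVn sqr_sqrtr ?sqnorm_ge0//.
have [->|n0] := eqVneq (sqnorm R m (vec_of_seq R m s)) 0; first by rewrite mulr0.
by rewrite mulVf.
Qed.

Lemma coord_normalize_le1 (R : realType) m (s : seq R) i :
  `|normalize m s ord0 i| <= 1.
Proof.
rewrite -(ler_pXn2r (n := 2))// ?nnegrE// expr1n real_normK ?num_real//.
apply: le_trans (sqnorm_normalize m s).
by rewrite /sqnorm (bigD1 i)//= lerDl sumr_ge0// => j _; exact: sqr_ge0.
Qed.

Lemma imeas_coord_normalize (R : realType) m d (T : measurableType d) i :
  imeas m (fun (_ : T) s => normalize (R := R) m s ord0 i).
Proof.
(* Square root and inverse are written as real powers, which are known to be measurable. *)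
have -> : (fun (_ : T) s => normalize (R := R) m s ord0 i) =
  (fun (_ : T) s => ((\sum_(i < m) nth 0 s i * nth 0 s i) `^ 2^-1) `^ (-1) * nth 0 s i).
  apply/funext => _; apply/funext => s; rewrite /normalize !mxE; congr (_ * _).
  rewrite powR12_sqrt; last by apply: sumr_ge0 => j _; rewrite -expr2 sqr_ge0.
  rewrite powR_inv1 ?sqrtr_ge0//; congr (Num.sqrt _)^-1.
  by apply: eq_bigr => j _; rewrite mxE expr2.
apply: imeasM; last exact: imeas_nth.
apply: (imeas_comp (phi := fun r : R => (r `^ 2^-1) `^ (-1))).
  exact: (measurableT_comp (measurable_powR _) (measurable_powR _)).
by apply: imeas_sum => j; apply: imeasM; exact: imeas_nth.
Qed.

Lemma bounded_imeas_cst (R : realType) d (c : R) :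
  @bounded_imeas R d (fun _ => c).
Proof. by split; [exists `|c| | exact: imeas_param]. Qed.

Lemma bounded_imeas_coord (R : realType) d i :
  @bounded_imeas R d (fun x => x ord0 i).
Proof.
split; last exact: imeas_coord_normalize.
by exists 1 => s; exact: coord_normalize_le1.
Qed.

Lemma bounded_imeasD (R : realType) d (f g : 'rV[R]_d.+1 -> R) :
  bounded_imeas f -> bounded_imeas g -> bounded_imeas (fun x => f x + g x).
Proof.
move=> [[C fC] mf] [[D gD] mg]; split; last exact: imeasD.
by exists (C + D) => s; apply: le_trans (ler_normD _ _) _; exact: lerD.
Qed.

Lemma bounded_imeasM (R : realType) d (f g : 'rV[R]_d.+1 -> R) :
  bounded_imeas f -> bounded_imeas g -> bounded_imeas (fun x => f x * g x).
Proof.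
move=> [[C fC] mf] [[D gD] mg]; split; last exact: imeasM.
by exists (C * D) => s; rewrite normrM ler_pM.
Qed.

Lemma bounded_imeas_max0 (R : realType) d (f : 'rV[R]_d.+1 -> R) :
  bounded_imeas f -> bounded_imeas (fun x => Num.max (f x) 0).
Proof.
move=> [[C fC] mf]; split.
  exists C => s; apply: le_trans (fC s).
  by case: (leP (f (normalize d.+1 s)) 0) => h //; rewrite normr0.
apply: (imeas_comp (phi := fun r : R => Num.max r 0)) mf.
by apply: measurable_maxr.
Qed.

Lemma bounded_imeasN (R : realType) d (f : 'rV[R]_d.+1 -> R) :
  bounded_imeas f -> bounded_imeas (fun x => - f x).
Proof.
move=> bf; have := bounded_imeasM (@bounded_imeas_cst R d (- 1)) bf.
by under [X in bounded_imeas X -> _]eq_fun => x do rewrite mulN1r.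
Qed.

Section sphere_functional.
Variables (R : realType) (d : nat).
Implicit Types f g u v : 'rV[R]_d.+1 -> R.

Let gw g (s : seq R) : \bar R :=
  (g (normalize d.+1 s) * gauss R d.+1 (vec_of_seq R d.+1 s))%:E.

Let Z : R := (normal_peak (1 : R))^-1 ^+ d.+1.

Let Z_gt0 : 0 < Z.
Proof. by rewrite exprn_gt0// invr_gt0 normal_peak_gt0. Qed.

Let sph_int_nnE g : sph_int_nn R d g = (iint R d.+1 (gw g) * (Z^-1)%:E)%E.
Proof. by rewrite /sph_int_nn iint_gauss. Qed.

Let gw_ge0 g : (forall x, 0 <= g x) -> forall s, (0 <= gw g s)%E.
Proof. by move=> g0 s; rewrite lee_fin mulr_ge0// expR_ge0. Qed.

Let imeas_gw g : bounded_imeas g -> imeas d.+1 (fun (_ : unit) => gw g).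
Proof.
move=> [_ mg]; apply: (imeas_comp (phi := EFin)); first exact/measurable_EFinP.
by apply: imeasM => //; exact: imeas_gauss.
Qed.

Lemma sph_int_nn_ge0 g : (forall x, 0 <= g x) -> (0 <= sph_int_nn R d g)%E.
Proof.
move=> g0; rewrite sph_int_nnE mule_ge0//; first exact/iint_ge0/gw_ge0.
by rewrite lee_fin invr_ge0 ltW.
Qed.

Lemma sph_int_nnD u v : bounded_imeas u -> bounded_imeas v ->
  (forall x, 0 <= u x) -> (forall x, 0 <= v x) ->
  sph_int_nn R d (fun x => u x + v x) = (sph_int_nn R d u + sph_int_nn R d v)%E.
Proof.
move=> bu bv u0 v0; rewrite !sph_int_nnE -ge0_muleDl; last 2 first.
- exact/iint_ge0/gw_ge0.
- exact/iint_ge0/gw_ge0.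
congr (_ * _)%E.
rewrite -(iintD tt (fun _ => gw_ge0 u0) (fun _ => gw_ge0 v0) (imeas_gw bu) (imeas_gw bv)).
by apply: eq_iint => s _; rewrite /gw -EFinD mulrDl.
Qed.

Lemma sph_int_nnZ (k : R) u : 0 <= k -> bounded_imeas u ->
  (forall x, 0 <= u x) ->
  sph_int_nn R d (fun x => k * u x) = (k%:E * sph_int_nn R d u)%E.
Proof.
move=> k0 bu u0; rewrite !sph_int_nnE muleA; congr (_ * _)%E.
rewrite -(iintZ tt k0 (fun _ => gw_ge0 u0) (imeas_gw bu)).
by apply: eq_iint => s _; rewrite /gw -EFinM mulrA.
Qed.

Lemma sph_int_nn_cst (k : R) : 0 <= k -> sph_int_nn R d (fun _ => k) = k%:E.
Proof.
move=> k0.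
have -> : (fun _ => k) = (fun _ : 'rV[R]_d.+1 => k * 1) by rewrite mulr1.
rewrite sph_int_nnZ//; last exact: bounded_imeas_cst.
rewrite sph_int_nnE (_ : iint _ _ _ = Z%:E).
  by rewrite -!EFinM mulfV ?gt_eqF// mulr1.
rewrite -iint_gauss; apply: eq_iint => s _.
by rewrite /gw mul1r.
Qed.

Lemma sph_int_nn_fin_num g : bounded_imeas g -> (forall x, 0 <= g x) ->
  sph_int_nn R d g \is a fin_num.
Proof.
move=> bg g0; rewrite ge0_fin_numE; last exact: sph_int_nn_ge0.
have [[C gC] _] := bg.
have C0 : 0 <= C by exact: le_trans (normr_ge0 _) (gC [::]).
rewrite (@le_lt_trans _ _ (C%:E))%E ?ltry//.
rewrite -(sph_int_nn_cst C0) !sph_int_nnE lee_pmul2r//; last by rewrite lte_fin invr_gt0.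
have gCw (_ : unit) s : (gw g s <= gw (fun _ => C) s)%E.
  rewrite lee_fin ler_wpM2r ?expR_ge0//.
  exact: le_trans (ler_norm _) (gC s).
exact: (le_iint tt (fun _ => gw_ge0 g0) gCw (imeas_gw bg)
  (imeas_gw (bounded_imeas_cst _ C))).
Qed.

(** Vectors with nonzero first coordinate normalize onto the sphere; the others, among them the
    origin, form a null set. *)
Lemma eq_sph_int_nn u v : bounded_imeas u -> bounded_imeas v ->
  (forall x, 0 <= u x) -> (forall x, 0 <= v x) ->
  (forall x, sphere R d x -> u x = v x) ->
  sph_int_nn R d u = sph_int_nn R d v.
Proof.
move=> bu bv u0 v0 uv; rewrite !sph_int_nnE; congr (_ * _)%E.
have uvw x s : x != 0 -> size s = d -> gw u (x :: s) = gw v (x :: s).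
  by move=> x0 _; rewrite /gw uv//; exact: sphere_normalize.
exact: (eq_iint_neq0 (t := tt) (fun _ => gw_ge0 u0) (fun _ => gw_ge0 v0)
  (imeas_gw bu) (imeas_gw bv) uvw).
Qed.

(** Any splitting of [f] into nonnegative parts may replace the canonical one, because
    [max(f, 0) + v = u + max(-f, 0)]. Linearity of [sph_int] rests on this freedom. *)
Lemma sph_int_subE f u v : bounded_imeas u -> bounded_imeas v ->
  (forall x, 0 <= u x) -> (forall x, 0 <= v x) ->
  (forall x, f x = u x - v x) -> 
  sph_int R d f = fine (sph_int_nn R d u) - fine (sph_int_nn R d v).
Proof.
move=> bu bv u0 v0 fE.
have bf : bounded_imeas f.
  by rewrite (funext fE : f = _); apply: bounded_imeasD => //; exact: bounded_imeasN.
have bp := bounded_imeas_max0 bf; have bn := bounded_imeas_max0 (bounded_imeasN bf).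
have p0 x : 0 <= Num.max (f x) 0 by rewrite le_max lexx orbT.
have n0 x : 0 <= Num.max (- f x) 0 by rewrite le_max lexx orbT.
rewrite /sph_int; apply/eqP; rewrite subr_eq addrAC eq_sym subr_eq; apply/eqP.
rewrite -!fineD ?sph_int_nn_fin_num//.
rewrite -!sph_int_nnD//; congr (fine (sph_int_nn R d _)).
apply/funext => x; rewrite fE.
by case: (leP (u x - v x) 0) => h1; case: (leP (- (u x - v x)) 0) => h2; lra.
Qed.

Lemma sph_int_cst (k : R) : sph_int R d (fun _ => k) = k.
Proof.
rewrite (@sph_int_subE _ (fun _ => Num.max k 0) (fun _ => Num.max (- k) 0))//.
- rewrite !sph_int_nn_cst ?le_max ?lexx ?orbT//=.
  by case: (leP k 0); case: (leP (- k) 0) => ? ?; lra.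
- exact: bounded_imeas_cst.
- exact: bounded_imeas_cst.
- by move=> x; rewrite le_max lexx orbT.
- by move=> x; rewrite le_max lexx orbT.
- by move=> x; case: (leP k 0); case: (leP (- k) 0) => ? ?; lra.
Qed.

Let pos f x := Num.max (f x) 0.
Let neg f x := Num.max (- f x) 0.
Let pos_ge0 f x : 0 <= pos f x. Proof. by rewrite le_max lexx orbT. Qed.
Let neg_ge0 f x : 0 <= neg f x. Proof. by rewrite le_max lexx orbT. Qed.
Let bounded_imeas_pos f : bounded_imeas f -> bounded_imeas (pos f).
Proof. exact: bounded_imeas_max0. Qed.
Let bounded_imeas_neg f : bounded_imeas f -> bounded_imeas (neg f).
Proof. by move=> bf; apply/bounded_imeas_max0/bounded_imeasN. Qed.
Let pos_neg f x : f x = pos f x - neg f x.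
Proof.
by rewrite /pos /neg; case: (leP (f x) 0); case: (leP (- f x) 0) => ? ?; lra.
Qed.

Lemma sph_intD f g : bounded_imeas f -> bounded_imeas g ->
  sph_int R d (fun x => f x + g x) = sph_int R d f + sph_int R d g.
Proof.
move=> bf bg.
have [bp bn] := (bounded_imeas_pos bf, bounded_imeas_neg bf).
have [bp' bn'] := (bounded_imeas_pos bg, bounded_imeas_neg bg).
rewrite (@sph_int_subE _ (fun x => pos f x + pos g x) (fun x => neg f x + neg g x)).
- rewrite !sph_int_nnD// !fineD ?sph_int_nn_fin_num// /sph_int.
  by rewrite opprD addrACA.
- exact: bounded_imeasD.
- exact: bounded_imeasD.
- by move=> x; rewrite addr_ge0.
- by move=> x; rewrite addr_ge0.
- by move=> x; rewrite (pos_neg f) (pos_neg g); ring.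
Qed.

Lemma sph_intN f : sph_int R d (fun x => - f x) = - sph_int R d f.
Proof.
rewrite /sph_int opprB; congr (_ - fine (sph_int_nn R d _)).
by apply/funext => x; rewrite opprK.
Qed.

Lemma sph_intZ (k : R) f : bounded_imeas f ->
  sph_int R d (fun x => k * f x) = k * sph_int R d f.
Proof.
move=> bf; wlog k0 : k / 0 <= k.
  move=> wk; have [/wk//|k0] := leP 0 k.
  have := wk (- k); rewrite oppr_ge0 ltW// => /(_ isT).
  under [X in sph_int R d X]eq_fun => x do rewrite mulNr.
  by rewrite sph_intN mulNr => /oppr_inj.
have [bp bn] := (bounded_imeas_pos bf, bounded_imeas_neg bf).
rewrite (@sph_int_subE _ (fun x => k * pos f x) (fun x => k * neg f x)).
- rewrite !sph_int_nnZ//.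
  rewrite -(fineK (sph_int_nn_fin_num bp (pos_ge0 f))).
  rewrite -(fineK (sph_int_nn_fin_num bn (neg_ge0 f))) -!EFinM.
  by rewrite /sph_int mulrBr.
- by apply: bounded_imeasM => //; exact: bounded_imeas_cst.
- by apply: bounded_imeasM => //; exact: bounded_imeas_cst.
- by move=> x; rewrite mulr_ge0.
- by move=> x; rewrite mulr_ge0.
- by move=> x; rewrite (pos_neg f) mulrBr.
Qed.

Lemma eq_sph_int f g : bounded_imeas f -> bounded_imeas g ->
  (forall x, sphere R d x -> f x = g x) -> sph_int R d f = sph_int R d g.
Proof.
move=> bf bg fg; rewrite /sph_int; congr (fine _ - fine _).
  apply: eq_sph_int_nn => //; try exact: bounded_imeas_pos; try exact: pos_ge0.
  by move=> x Sx; rewrite fg.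
apply: eq_sph_int_nn => //; try exact: bounded_imeas_neg; try exact: neg_ge0.
by move=> x Sx; rewrite fg.
Qed.

Lemma sph_int_ge0 f : bounded_imeas f ->
  (forall x, sphere R d x -> 0 <= f x) -> 0 <= sph_int R d f.
Proof.
move=> bf f0.
rewrite (@eq_sph_int f (pos f))//; last 2 first.
- exact: bounded_imeas_pos.
- by move=> x Sx; rewrite /pos max_l// f0.
have := bounded_imeas_pos bf => bp.
rewrite (@sph_int_subE _ (pos f) (fun _ => 0))//; last first.
- by move=> x; rewrite subr0.
- exact: bounded_imeas_cst.
rewrite sph_int_nn_cst//= subr0; apply/fine_ge0/sph_int_nn_ge0; exact: pos_ge0.
Qed.

(** The Gaussian weight depends on the norm alone, so invariance of the iterated integral passes to
    the sphere. *)
Lemma sph_int_rotate_at (a : R) k f g : (k < d)%N ->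
  bounded_imeas f ->
  let c := (1 - a ^+ 2) / (1 + a ^+ 2) in
  let s := 2 * a / (1 + a ^+ 2) in
  (forall l, size l = d.+1 ->
     f (normalize d.+1 (rotate_at c s k l)) = g (normalize d.+1 l)) ->
  (forall l, size l = d.+1 ->
     sqnorm R d.+1 (vec_of_seq R d.+1 (rotate_at c s k l)) =
     sqnorm R d.+1 (vec_of_seq R d.+1 l)) ->
  sph_int R d g = sph_int R d f.
Proof.
move=> kd bf c s fg nrm.
have nnE u v : bounded_imeas u -> (forall x, 0 <= u x) ->
    (forall l, size l = d.+1 ->
      u (normalize d.+1 (rotate_at c s k l)) = v (normalize d.+1 l)) ->
    sph_int_nn R d v = sph_int_nn R d u.
  move=> bu u0 uv; rewrite !sph_int_nnE; congr (_ * _)%E.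
  have kd' : (k.+1 < d.+1)%N := kd.
  rewrite -(iint_rotate_at a tt kd' (fun _ => gw_ge0 u0) (imeas_gw bu)).
  by apply: eq_iint => l sl; rewrite /gw -/c -/s uv// /gauss nrm.
rewrite /sph_int; congr (fine _ - fine _); apply: nnE.
- exact: bounded_imeas_pos.
- exact: pos_ge0.
- by move=> l sl; rewrite fg.
- exact: bounded_imeas_neg.
- exact: neg_ge0.
- by move=> l sl; rewrite fg.
Qed.

End sphere_functional.

(** * Polynomials and infinitesimal rotations *)

(* Polynomial functions are handled through expressions, on which differentiation
   is structural. *)
Inductive pexp (R : realType) m :=
  | PC of R | PX of 'I_m | PD of pexp R m & pexp R m | PM of pexp R m & pexp R m.
Arguments PC {R m}.
Arguments PX {R m}.
Arguments PD {R m}.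
Arguments PM {R m}.

Section polynomial_expressions.
Variables (R : realType) (m : nat).
Implicit Types (e : pexp R m) (x : 'rV[R]_m).

Fixpoint pev e x : R :=
  match e with
  | PC c => c
  | PX i => x ord0 i
  | PD e1 e2 => pev e1 x + pev e2 x
  | PM e1 e2 => pev e1 x * pev e2 x
  end.

Fixpoint pder (i : 'I_m) e : pexp R m :=
  match e with
  | PC _ => PC 0
  | PX j => PC (i == j)%:R
  | PD e1 e2 => PD (pder i e1) (pder i e2)
  | PM e1 e2 => PD (PM (pder i e1) e2) (PM e1 (pder i e2))
  end.

Definition psub e1 e2 := PD e1 (PM (PC (-1)) e2).
Definition psum (I : Type) (r : seq I) (F : I -> pexp R m) : pexp R m :=
  foldr (fun i => PD (F i)) (PC 0) r.
Definition pexpn e n : pexp R m := iter n (PM e) (PC 1).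

Lemma pev_psub e1 e2 x : pev (psub e1 e2) x = pev e1 x - pev e2 x.
Proof. by rewrite /= mulN1r. Qed.

Lemma pev_psum (I : Type) (r : seq I) F x :
  pev (psum r F) x = \sum_(i <- r) pev (F i) x.
Proof. by elim: r => [|i r IH] /=; rewrite ?big_nil// big_cons IH. Qed.

Lemma pev_pexpn e n x : pev (pexpn e n) x = pev e x ^+ n.
Proof. by elim: n => [|n IHn] /=; rewrite ?expr0// exprS -IHn. Qed.

Lemma pder_psum i (I : Type) (r : seq I) F :
  pder i (psum r F) = psum r (fun j => pder i (F j)).
Proof. by elim: r => [|j r IH] //=; rewrite IH. Qed.

Lemma pev_pder_pexpn i e n x :
  pev (pder i (pexpn e n)) x = n%:R * pev e x ^+ n.-1 * pev (pder i e) x.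
Proof.
elim: n => [|n IHn] /=; first by rewrite mul0r mul0r.
rewrite -/(pexpn e n) IHn pev_pexpn; case: n {IHn} => [|n] /=.
  by rewrite expr0; ring.
by rewrite exprS -[n.+2]addn1 natrD; ring.
Qed.

Lemma pderC i j e x : pev (pder i (pder j e)) x = pev (pder j (pder i e)) x.
Proof.
elim: e => [c|k|e1 IH1 e2 IH2|e1 IH1 e2 IH2] //=; rewrite ?IH1 ?IH2//.
ring.
Qed.

(* Infinitesimal rotation in the coordinates [i], [j]. *)
Definition prot i j e : pexp R m :=
  psub (PM (PX i) (pder j e)) (PM (PX j) (pder i e)).

Lemma pev_prot i j e x :
  pev (prot i j e) x =
  x ord0 i * pev (pder j e) x - x ord0 j * pev (pder i e) x.
Proof. by rewrite /prot pev_psub. Qed.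

Lemma pev_protM i j e1 e2 x : pev (prot i j (PM e1 e2)) x =
  pev (prot i j e1) x * pev e2 x + pev e1 x * pev (prot i j e2) x.
Proof. by rewrite !pev_prot /=; ring. Qed.

Lemma pev_prot_prot i j e x : pev (prot i j (prot i j e)) x =
  x ord0 i * ((i == j)%:R * pev (pder j e) x + x ord0 i * pev (pder j (pder j e)) x
     - pev (pder i e) x - x ord0 j * pev (pder j (pder i e)) x)
  - x ord0 j * (pev (pder j e) x + x ord0 i * pev (pder i (pder j e)) x
     - (i == j)%:R * pev (pder i e) x - x ord0 j * pev (pder i (pder i e)) x).
Proof. by rewrite pev_prot /= !eqxx [j == i]eq_sym /=; ring. Qed.

(** Commutation relation of the Lie algebra of rotations; it generates all coordinate pairs from
    neighbouring ones. *)
Lemma prot_comm i j k e x : i != j -> j != k -> i != k ->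
  pev (prot i j (prot j k e)) x - pev (prot j k (prot i j e)) x =
  pev (prot i k e) x.
Proof.
move=> /negPf ij /negPf jk /negPf ik; rewrite !pev_prot /=.
rewrite !eqxx ij jk ik [k == j]eq_sym jk [k == i]eq_sym ik [j == i]eq_sym ij.
rewrite (pderC k j) (pderC k i) (pderC j i) /=; ring.
Qed.

Definition peuler e x := \sum_(i < m) x ord0 i * pev (pder i e) x.
Definition plap e x := \sum_(i < m) pev (pder i (pder i e)) x.
Definition phess e x :=
  \sum_(i < m) \sum_(j < m) x ord0 i * x ord0 j * pev (pder i (pder j e)) x.
(** Quadratic Casimir of the rotation group; ordered pairs count each infinitesimal rotation
    twice. *)
Definition pcas e x := \sum_(i < m) \sum_(j < m) pev (prot i j (prot i j e)) x.

(** In this form the Casimir can be evaluated both on homogeneous harmonic polynomials, by Euler's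
    identity, and on powers of [halfdot]. *)
Lemma pcasE e x : pcas e x =
  2 * (sqnorm R m x * plap e x - phess e x - (m%:R - 1) * peuler e x).
Proof.
have -> : pcas e x = \sum_(i < m) \sum_(j < m)
   ((x ord0 i ^+ 2 * pev (pder j (pder j e)) x + x ord0 j ^+ 2 * pev (pder i (pder i e)) x)
   - 2 * (x ord0 i * x ord0 j * pev (pder i (pder j e)) x)
   - (x ord0 i * pev (pder i e) x + x ord0 j * pev (pder j e) x)
   + (i == j)%:R * (x ord0 i * pev (pder j e) x + x ord0 j * pev (pder i e) x)).
  apply: eq_bigr => i _; apply: eq_bigr => j _; rewrite pev_prot_prot (pderC j i).
  by ring.
pose S (F : 'I_m -> 'I_m -> R) := \sum_(i < m) \sum_(j < m) F i j.
have SD F G : S (fun i j => F i j + G i j) = S F + S G.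
  by rewrite /S -big_split; apply: eq_bigr => i _; rewrite big_split.
have SZ a F : S (fun i j => a * F i j) = a * S F.
  by rewrite /S mulr_sumr; apply: eq_bigr => i _; rewrite mulr_sumr.
have SN F : S (fun i j => - F i j) = - S F.
  by rewrite /S -sumrN; apply: eq_bigr => i _; rewrite sumrN.
have Ssym F : S (fun i j => F j i) = S F by exact: exchange_big.
rewrite -/(S _) !SD !SN SZ !SD.
rewrite (Ssym (fun i j => x ord0 i ^+ 2 * pev (pder j (pder j e)) x)).
rewrite (Ssym (fun i j => x ord0 i * pev (pder i e) x)).
have -> : S (fun i j => x ord0 i ^+ 2 * pev (pder j (pder j e)) x) =
    sqnorm R m x * plap e x.
  by rewrite /sqnorm mulr_suml; apply: eq_bigr => i _; rewrite -mulr_sumr.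
have -> : S (fun i j => x ord0 i * pev (pder i e) x) = m%:R * peuler e x.
  rewrite /peuler mulr_sumr; apply: eq_bigr => i _.
  by rewrite sumr_const card_ord mulr_natl.
have -> : S (fun i j => (i == j)%:R *
    (x ord0 i * pev (pder j e) x + x ord0 j * pev (pder i e) x)) = 2 * peuler e x.
  rewrite /peuler mulr_sumr; apply: eq_bigr => i _.
  rewrite (bigD1 i)//= eqxx big1 ?addr0; last by
    move=> j /negPf ji; rewrite eq_sym ji mul0r.
  by rewrite /=; ring.
by rewrite -[S _]/(phess e x); ring.
Qed.

End polynomial_expressions.

Lemma is_derive_coord (R : realType) m (x v : 'rV[R]_m) (j : 'I_m) :
  is_derive x v (fun y : 'rV[R]_m => y ord0 j) (v ord0 j).
Proof.
have cv : (fun h : R => h^-1 *: (((h *: v + x) ord0 j : R) - x ord0 j)) @ 0^' -->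
    (v ord0 j : R).
  apply: cvg_near_cst; near=> h.
  rewrite !mxE addrK /GRing.scale/= mulrA mulVf ?mul1r//.
  by near: h; exact: nbhs_dnbhs_neq.
apply: DeriveDef; first by apply/cvg_ex; exists (v ord0 j).
exact: cvg_lim cv.
Unshelve. all: by end_near. Qed.

(** * Formal and analytic derivatives, Euler's identity *)

Section calculus.
Variables (R : realType) (m : nat).
Implicit Types (e : pexp R m) (x : 'rV[R]_m).

Lemma unitvecE (i j : 'I_m) : unitvec R m i ord0 j = (i == j)%:R.
Proof. by rewrite mxE. Qed.

Lemma is_derive_pev e x (i : 'I_m) :
  is_derive x (unitvec R m i) (pev e) (pev (pder i e) x).
Proof.
elim: e => [c|j|e1 IH1 e2 IH2|e1 IH1 e2 IH2].
- exact: is_derive_cst.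
- by have := is_derive_coord x (unitvec R m i) j; rewrite unitvecE.
- exact: is_deriveD.
- apply: (is_derive_eq (is_deriveM IH1 IH2)).
  rewrite -[LHS]/(pev e1 x * pev (pder i e2) x + pev e2 x * pev (pder i e1) x).
  by rewrite -[RHS]/(pev (pder i e1) x * pev e2 x + pev e1 x * pev (pder i e2) x); ring.
Qed.

Lemma derive_pev e x (i : 'I_m) :
  'D_(unitvec R m i) (pev e) x = pev (pder i e) x.
Proof. by have [] := is_derive_pev e x i. Qed.

(** Formal derivatives depend only on the function denoted, since they compute the analytic ones;
    expressions can thus be exchanged under [pder]. *)
Lemma eq_pev_pder e1 e2 : pev e1 = pev e2 ->
  forall i x, pev (pder i e1) x = pev (pder i e2) x.
Proof. by move=> e12 i x; rewrite -!derive_pev e12. Qed.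

Lemma laplacian_pev e x : laplacian R m (pev e) x = plap e x.
Proof.
apply: eq_bigr => i _; rewrite -derive_pev; congr ('D_(_) _ x).
by apply/funext => y; rewrite derive_pev.
Qed.

Lemma continuous_pev e : continuous (pev e).
Proof.
elim: e => [c|j|e1 IH1 e2 IH2|e1 IH1 e2 IH2] x /=.
- exact: cst_continuous.
- exact: coord_continuous.
- by apply: continuousD; [exact: IH1|exact: IH2].
- by apply: continuousM; [exact: IH1|exact: IH2].
Qed.

Lemma peulerM e1 e2 x :
  peuler (PM e1 e2) x = peuler e1 x * pev e2 x + pev e1 x * peuler e2 x.
Proof.
rewrite /peuler mulr_suml mulr_sumr -big_split; apply: eq_bigr => i _ /=; ring.
Qed.

Lemma peulerX j x : peuler (PX j) x = x ord0 j.
Proof.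
rewrite /peuler (bigD1 j)//= eqxx mulr1 big1 ?addr0// => i /negPf ij.
by rewrite ij mulr0.
Qed.

Lemma peuler_pexpn e k x n : peuler e x = k%:R * pev e x ->
  peuler (pexpn e n) x = (n * k)%:R * pev (pexpn e n) x.
Proof.
move=> ek; elim: n => [|n IHn] /=.
  by rewrite /peuler big1 ?mul0r// => i _; rewrite mulr0.
by rewrite peulerM IHn ek /= mulSn natrD; ring.
Qed.

Definition pmono (f : 'I_m -> nat) : pexp R m :=
  foldr (fun i => PM (pexpn (PX i) (f i))) (PC 1) (index_enum 'I_m).

Lemma pev_pmono f x : pev (pmono f) x = monomial R m f x.
Proof.
rewrite /monomial /pmono; elim: (index_enum _) => [|i r IH] /=.
  by rewrite big_nil.
by rewrite big_cons IH pev_pexpn.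
Qed.

Lemma peuler_pmono f x : peuler (pmono f) x = (\sum_(i < m) f i)%:R * pev (pmono f) x.
Proof.
rewrite /pmono; elim: (index_enum _) => [|i r IH] /=.
  by rewrite big_nil /peuler big1 ?mul0r// => i _; rewrite mulr0.
rewrite peulerM IH big_cons natrD (@peuler_pexpn _ 1) ?muln1 ?mul1r ?peulerX//.
by rewrite mulrDl; ring.
Qed.

Lemma homog_polyP l (P : 'rV[R]_m -> R) : homog_poly R m l P ->
  exists e, P = pev e /\ forall x, peuler e x = l%:R * pev e x.
Proof.
case=> s [sl PE].
exists (psum s (fun t => PM (PC t.2) (pmono t.1))); split.
  apply/funext => x; rewrite PE pev_psum; apply: eq_bigr => t _ /=.
  by rewrite pev_pmono.
move=> x; rewrite {PE P}.
elim: s sl => [|t s IH] sl /=.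
  by rewrite /peuler big1 ?mulr0// => i _; rewrite mulr0.
have peulerD (e1 e2 : pexp R m) : peuler (PD e1 e2) x = peuler e1 x + peuler e2 x.
  by rewrite /peuler -big_split; apply: eq_bigr => i _ /=; rewrite mulrDr.
rewrite peulerD peulerM IH; last by move=> u us; apply: sl; rewrite inE us orbT.
rewrite peuler_pmono (sl t (mem_head _ _)) /=.
have -> : peuler (PC t.2) x = 0 by rewrite /peuler big1// => i _; rewrite mulr0.
by ring.
Qed.

(** Apply the Euler operator to both sides of Euler's identity: applied to the left side, the
    expression [E], it produces the Hessian form plus one further [peuler e]. *)
Lemma phess_homog e (l : nat) : (forall x, peuler e x = l%:R * pev e x) ->
  forall x, phess e x = (l%:R ^+ 2 - l%:R) * pev e x.
Proof.
move=> el x.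
pose E := psum (index_enum 'I_m) (fun i => PM (PX i) (pder i e)).
have EE : pev E = pev (PM (PC l%:R) e).
  by apply/funext => y; rewrite pev_psum /= -el.
have : peuler E x = l%:R * peuler e x.
  rewrite /peuler mulr_sumr; apply: eq_bigr => i _.
  by rewrite (eq_pev_pder EE) /=; ring.
have -> : peuler E x = peuler e x + phess e x.
  rewrite /peuler /phess -big_split; apply: eq_bigr => i _.
  rewrite /E pder_psum pev_psum.
  under eq_bigr => j _ do rewrite /=.
  rewrite big_split/= mulrDr; congr (_ + _).
    rewrite (bigD1 i)//= eqxx mul1r big1 ?addr0// => j /negPf ji.
    by rewrite eq_sym ji mul0r.
  by rewrite mulr_sumr; apply: eq_bigr => j _; rewrite mulrA.
rewrite el => h; apply: (addrI (l%:R * pev e x)); rewrite h; ring.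
Qed.

End calculus.

(* On the sphere [pcas] is twice the Laplace-Beltrami operator. *)
Lemma sph_harmP (R : realType) d l (Y : 'rV[R]_d.+1 -> R) : sph_harm R d l Y ->
  exists e, Y = pev e /\
    forall x, pcas e x = - 2 * (l * (l + d - 1))%:R * pev e x.
Proof.
move=> [/homog_polyP [e [-> el]] lapY]; exists e; split => // x.
rewrite pcasE -laplacian_pev lapY mulr0 (phess_homog el) el.
(* For [l = 0] the eigenvalue is 0 whatever the truncated subtraction yields; for a successor the
   subtraction is exact. *)
case: l {el lapY} => [|l]; first by rewrite mul0n; ring.
rewrite addSn subn1 /= natrM !natrD -!natr1; ring.
Qed.

(** * Rotation invariance of the surface integral *)

Lemma bounded_imeas_pev (R : realType) d (e : pexp R d.+1) : bounded_imeas (pev e).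
Proof.
elim: e => [c|i|e1 IH1 e2 IH2|e1 IH1 e2 IH2].
- exact: bounded_imeas_cst.
- exact: bounded_imeas_coord.
- exact: bounded_imeasD.
- exact: bounded_imeasM.
Qed.

Section rotation_invariance.
Variables (R : realType) (d : nat).
Local Notation n := d.+1.
Local Notation sI := (sph_int R d).
Implicit Types (e : pexp R n) (x : 'rV[R]_n).

Lemma sph_int_abs_le f (C : R) : bounded_imeas f ->
  (forall x, sphere R d x -> `|f x| <= C) -> `|sI f| <= C.
Proof.
move=> bf fC; rewrite ler_norml; apply/andP; split.
  have := @sph_int_ge0 R d (fun x => f x + C).
  rewrite sph_intD ?sph_int_cst; [|done|exact: bounded_imeas_cst].
  rewrite -lerBlDr sub0r; apply; first by apply: bounded_imeasD => //; exact: bounded_imeas_cst.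
  by move=> x /fC; rewrite ler_norml => /andP[]; rewrite -subr_ge0 opprK.
have := @sph_int_ge0 R d (fun x => - f x + C).
rewrite sph_intD ?sph_int_cst ?sph_intN; [|exact: bounded_imeasN|exact: bounded_imeas_cst].
rewrite addrC subr_ge0; apply.
  by apply: bounded_imeasD; [exact: bounded_imeasN|exact: bounded_imeas_cst].
by move=> x /fC; rewrite ler_norml => /andP[_]; rewrite -subr_ge0 addrC.
Qed.

Definition vrot (c s : R) (i j : 'I_n) (x : 'rV[R]_n) : 'rV[R]_n :=
  \row_l (if l == i then c * x ord0 i - s * x ord0 j
          else if l == j then s * x ord0 i + c * x ord0 j else x ord0 l).

Lemma vrotZ c s i j (a : R) x : vrot c s i j (a *: x) = a *: vrot c s i j x.
Proof. by apply/rowP => l; rewrite !mxE; case: ifP => _; [|case: ifP => _]; ring. Qed.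

Lemma sqnorm_vrot c s i j x : c ^+ 2 + s ^+ 2 = 1 -> i != j ->
  sqnorm R n (vrot c s i j x) = sqnorm R n x.
Proof.
move=> cs ij; rewrite /sqnorm (bigD1 i)//= [in RHS](bigD1 i)//=.
rewrite (bigD1 j) 1?eq_sym//= [in RHS](bigD1 j) 1?eq_sym//= !addrA.
congr (_ + _).
  rewrite !mxE !eqxx [j == i]eq_sym (negPf ij).
  have -> : x ord0 i ^+ 2 + x ord0 j ^+ 2 =
    (c ^+ 2 + s ^+ 2) * (x ord0 i ^+ 2 + x ord0 j ^+ 2) by rewrite cs mul1r.
  by ring.
by apply: eq_bigr => l /andP[/negPf li /negPf lj]; rewrite !mxE li lj.
Qed.

Lemma vec_of_seq_rotate_at c s (i j : 'I_n) (l : seq R) :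
  nat_of_ord j = i.+1 -> size l = n ->
  vec_of_seq R n (rotate_at c s i l) = vrot c s i j (vec_of_seq R n l).
Proof.
move=> ji sl; apply/rowP => k; rewrite !mxE.
have nthE (k0 : nat) (l0 : seq R) q : (k0.+1 < size l0)%N ->
    nth 0 (rotate_at c s k0 l0) q =
    if q == k0 then c * nth 0 l0 k0 - s * nth 0 l0 k0.+1
    else if q == k0.+1 then s * nth 0 l0 k0 + c * nth 0 l0 k0.+1 else nth 0 l0 q.
  elim: k0 l0 q => [|k0 IH] [|x [|y l0]] [|q] //= h.
    by case: q => [|q].
  by rewrite IH.
rewrite nthE ?sl -?ji//.
Qed.

Lemma bounded_imeas_vrot c s i j e : bounded_imeas (fun x => pev e (vrot c s i j x)).
Proof.
elim: e => [k|l|e1 IH1 e2 IH2|e1 IH1 e2 IH2].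
- exact: bounded_imeas_cst.
- pose el : pexp R n := if l == i then PD (PM (PC c) (PX i)) (PM (PC (- s)) (PX j))
    else if l == j then PD (PM (PC s) (PX i)) (PM (PC c) (PX j)) else PX l.
  have -> : (fun x => pev (PX l) (vrot c s i j x)) = pev el.
    apply/funext => x; rewrite /el /= mxE; case: ifP => _ /=; first by rewrite mulNr.
    by case: ifP.
  exact: bounded_imeas_pev.
- exact: bounded_imeasD.
- exact: bounded_imeasM.
Qed.

Lemma sph_int_vrot a (i j : 'I_n) e : nat_of_ord j = i.+1 ->
  let c := (1 - a ^+ 2) / (1 + a ^+ 2) in
  let s := 2 * a / (1 + a ^+ 2) in
  sI (fun x => pev e (vrot c s i j x)) = sI (pev e).
Proof.
move=> ji c s.
have a1 : 1 + a ^+ 2 != 0 by rewrite gt_eqF// ltr_pwDl// sqr_ge0.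
have cs : c ^+ 2 + s ^+ 2 = 1 by rewrite /c /s; field.
have ij : i != j by apply/eqP => ij; move: ji; rewrite ij => /n_Sn.
have nrm l : size l = n -> sqnorm R n (vec_of_seq R n (rotate_at c s i l)) =
    sqnorm R n (vec_of_seq R n l).
  by move=> sl; rewrite (vec_of_seq_rotate_at _ _ ji)// sqnorm_vrot.
apply: (@sph_int_rotate_at R d a i) => //.
- by have := ltn_ord j; rewrite ji.
- exact: bounded_imeas_pev.
- move=> l sl; congr (pev e _).
  by rewrite /normalize /enorm nrm// (vec_of_seq_rotate_at _ _ ji)// vrotZ.
Qed.

Lemma sphere_coord_le1 x i : sphere R d x -> `|x ord0 i| <= 1.
Proof.
move=> xS; rewrite -(ler_pXn2r (n := 2))// ?nnegrE// expr1n.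
rewrite real_normK ?num_real// -[leRHS]xS /sqnorm (bigD1 i)//= lerDl.
by apply: sumr_ge0 => j _; exact: sqr_ge0.
Qed.

Lemma pev_bound e : exists2 C : R, 0 <= C & forall x, sphere R d x -> `|pev e x| <= C.
Proof.
elim: e => [c|i|e1 [C1 C10 IH1] e2 [C2 C20 IH2]|e1 [C1 C10 IH1] e2 [C2 C20 IH2]] /=.
- by exists `|c|.
- by exists 1 => // x xS; exact: sphere_coord_le1.
- exists (C1 + C2); first exact: addr_ge0.
  move=> x xS; apply: le_trans (ler_normD _ _) _.
  by apply: lerD; [exact: IH1|exact: IH2].
- exists (C1 * C2); first exact: mulr_ge0.
  by move=> x xS; rewrite normrM ler_pM// ?IH1 ?IH2.
Qed.

(** First-order expansion of a rotation, uniform on the sphere. As [a] is the tangent of half the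
    angle, the angle is [2 * a] to first order. *)
Lemma pev_vrot_taylor (i j : 'I_n) e : i != j -> exists2 C : R, 0 <= C &
  forall a : R, 0 <= a <= 1 ->
  let c := (1 - a ^+ 2) / (1 + a ^+ 2) in
  let s := 2 * a / (1 + a ^+ 2) in
  forall x, sphere R d x ->
  `|pev e (vrot c s i j x) - pev e x - 2 * a * pev (prot i j e) x| <= C * a ^+ 2.
Proof.
move=> ij; elim: e => [k|l|p [C1 C10 IH1] q [C2 C20 IH2]|p [C1 C10 IH1] q [C2 C20 IH2]].
- exists 0 => // a _ c s x _.
  by rewrite pev_prot /= subrr !mulr0 subrr mulr0 subrr normr0 mul0r.
- exists 4 => // a /andP[a0 a1] c s x xS.
  have coordle k : `|x ord0 k| <= 1 by exact: sphere_coord_le1.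
  have q1 : 0 < 1 + a ^+ 2 by rewrite ltr_pwDl// sqr_ge0.
  (* Cosine and sine are their first-order parts [1] and [2 * a] minus [a ^+ 2] times quantities in
     [[0, 2]]. *)
  have cE : c = 1 - a ^+ 2 * (2 / (1 + a ^+ 2)).
    by rewrite /c; field; rewrite gt_eqF.
  have sE : s = 2 * a - a ^+ 2 * (2 * a / (1 + a ^+ 2)).
    by rewrite /s; field; rewrite gt_eqF.
  have c2 : 0 <= 2 / (1 + a ^+ 2) <= 2.
    apply/andP; split; first by rewrite divr_ge0// ltW.
    by rewrite ler_pdivrMr// ler_peMr// lerDl sqr_ge0.
  have s2 : 0 <= 2 * a / (1 + a ^+ 2) <= 2.
    apply/andP; split; first by rewrite divr_ge0 ?mulr_ge0// ltW.
    by rewrite ler_pdivrMr// ler_pM2l// (le_trans a1)// lerDl sqr_ge0.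
  move: c2 s2 cE sE; move: (2 / _) (2 * a / _) => c2 s2 /andP[c20 c22] /andP[s20 s22] cE sE.
  rewrite pev_prot /= mxE.
  have bound (u v : R) : `|u| <= 1 -> `|v| <= 1 -> `|a ^+ 2 * (c2 * u + s2 * v)| <= 4 * a ^+ 2.
    move=> u1 v1; rewrite normrM ger0_norm ?sqr_ge0// mulrC ler_wpM2r ?sqr_ge0//.
    apply: le_trans (ler_normD _ _) _; rewrite !normrM !(ger0_norm c20) !(ger0_norm s20).
    rewrite (_ : 4 = 2 * 1 + 2 * 1); last by ring.
    by apply: lerD; apply: ler_pM.
  have [->|li] := eqVneq l i.
    rewrite ?eqxx [j == i]eq_sym (negPf ij) /= cE sE.
    set w := (X in `|X|).
    have -> : w = a ^+ 2 * (c2 * (- x ord0 i) + s2 * x ord0 j) by rewrite /w; ring.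
    by apply: bound; rewrite ?normrN.
  have [->|lj] := eqVneq l j.
    rewrite ?eqxx /= cE sE.
    set w := (X in `|X|).
    have -> : w = a ^+ 2 * (c2 * (- x ord0 j) + s2 * (- x ord0 i)) by rewrite /w; ring.
    by apply: bound; rewrite ?normrN.
  set w := (X in `|X|); have -> : w = 0 by rewrite /w /=; ring.
  by rewrite normr0 mulr_ge0// sqr_ge0.
- exists (C1 + C2); first exact: addr_ge0.
  move=> a a01 c s x xS; rewrite [leRHS]mulrDl.
  have -> : pev (PD p q) (vrot c s i j x) - pev (PD p q) x - 2 * a * pev (prot i j (PD p q)) x =
    (pev p (vrot c s i j x) - pev p x - 2 * a * pev (prot i j p) x) +
    (pev q (vrot c s i j x) - pev q x - 2 * a * pev (prot i j q) x).
    by rewrite !pev_prot /=; ring.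
  by apply: le_trans (ler_normD _ _) _; apply: lerD; [exact: IH1|exact: IH2].
- have [B1 B10 HB1] := pev_bound p; have [B2 B20 HB2] := pev_bound q.
  have [A1 A10 HA1] := pev_bound (prot i j p); have [A2 A20 HA2] := pev_bound (prot i j q).
  (* One summand for each term of the splitting below: the remainder of [p], the remainder of [q],
     and the product of the two first-order terms. *)
  exists (C1 * B2 + (B1 + 2 * A1) * C2 + 4 * (A1 * A2)).
    by rewrite !addr_ge0// !mulr_ge0// addr_ge0// mulr_ge0.
  move=> a a01 c s x xS; have /andP[a0 a1] := a01.
  have vS : sphere R d (vrot c s i j x).
    rewrite /sphere/= sqnorm_vrot//.
    have q1 : 1 + a ^+ 2 != 0 by rewrite gt_eqF// ltr_pwDl// sqr_ge0.
    by rewrite /c /s; field.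
  have -> : pev (PM p q) (vrot c s i j x) - pev (PM p q) x - 2 * a * pev (prot i j (PM p q)) x =
    (pev p (vrot c s i j x) - pev p x - 2 * a * pev (prot i j p) x) * pev q (vrot c s i j x) +
    (pev p x + 2 * a * pev (prot i j p) x) *
      (pev q (vrot c s i j x) - pev q x - 2 * a * pev (prot i j q) x) +
    4 * (pev (prot i j p) x * pev (prot i j q) x) * a ^+ 2.
    by rewrite pev_protM /=; ring.
  rewrite [leRHS]mulrDl [X in _ <= X + _]mulrDl.
  apply: le_trans (ler_normD _ _) _; apply: lerD.
    apply: le_trans (ler_normD _ _) _; apply: lerD.
      rewrite normrM [leRHS]mulrAC ler_pM//; first exact: IH1.
      exact: HB2.
    rewrite normrM -[leRHS]mulrA ler_pM//; last exact: IH2.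
    apply: le_trans (ler_normD _ _) _; apply: lerD; first exact: HB1.
    rewrite normrM ger0_norm ?mulr_ge0// ler_pM ?mulr_ge0//; last exact: HA1.
    by rewrite ler_piMr.
  rewrite normrM (ger0_norm (sqr_ge0 a)) ler_wpM2r ?sqr_ge0//.
  rewrite normrM ger0_norm// ler_pM2l// normrM ler_pM//; [exact: HA1|exact: HA2].
Qed.

(** By rotation invariance the zeroth-order part of the expansion cancels in the integral; dividing
    by [2 * a] leaves a quantity of order [a], which can be made arbitrarily small. *)
Lemma sph_int_prot_adj (i j : 'I_n) e : nat_of_ord j = i.+1 ->
  sI (pev (prot i j e)) = 0.
Proof.
move=> ji.
have ij : i != j by apply/eqP => ij; move: ji; rewrite ij => /n_Sn.
have [C C0 HC] := pev_vrot_taylor e ij.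
have key (a : R) : 0 < a <= 1 -> `|sI (pev (prot i j e))| <= C * a.
  move=> /andP[a0 a1].
  pose c := (1 - a ^+ 2) / (1 + a ^+ 2); pose s := 2 * a / (1 + a ^+ 2).
  have := @sph_int_abs_le (fun x => pev e (vrot c s i j x) - pev e x -
     2 * a * pev (prot i j e) x) (C * a ^+ 2).
  have bv := bounded_imeas_vrot c s i j e.
  have be := bounded_imeas_pev e.
  have bp : bounded_imeas (fun x => 2 * a * pev (prot i j e) x).
    apply: bounded_imeasM; first exact: bounded_imeas_cst.
    exact: bounded_imeas_pev.
  have bve : bounded_imeas (fun x => pev e (vrot c s i j x) - pev e x).
    by apply: bounded_imeasD => //; exact: bounded_imeasN.
  rewrite (@sph_intD _ _ _ (fun x => - (2 * a * pev (prot i j e) x)))//; last exact: bounded_imeasN.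
  rewrite (@sph_intD _ _ _ (fun x => - pev e x))//; last exact: bounded_imeasN.
  rewrite !sph_intN sph_intZ; last exact: bounded_imeas_pev.
  rewrite sph_int_vrot// subrr add0r normrN.
  have -> : `|2 * a * sI (pev (prot i j e))| = 2 * a * `|sI (pev (prot i j e))|.
    by rewrite normrM ger0_norm// mulr_ge0// ltW.
  move=> h; have {}h : 2 * a * `|sI (pev (prot i j e))| <= C * a ^+ 2.
    apply: h; first by apply: bounded_imeasD => //; exact: bounded_imeasN.
    by move=> x xS; apply: HC => //; rewrite ltW.
  have h1 : 2 * `|sI (pev (prot i j e))| <= C * a.
    rewrite -(ler_pM2l a0) (_ : a * (C * a) = C * a ^+ 2); last by ring.
    by rewrite mulrA [a * 2]mulrC.
  apply: le_trans h1; rewrite mulr_natl mulr2n lerDl//.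
apply/eqP; rewrite -normr_eq0 eq_le normr_ge0 andbT leNgt; apply/negP => I0.
set I := `|_| in key I0.
(* At this parameter the bound [C * a] is smaller than [I]; the [+ 1] covers [C = 0]. *)
have := key (Num.min 1 (I / (2 * (C + 1)))).
have C1 : 0 < 2 * (C + 1) by lra.
rewrite lt_min ltr01 divr_gt0//= ge_min lexx => /(_ isT).
apply/negP; rewrite -ltNge.
apply: (@le_lt_trans _ _ (C * (I / (2 * (C + 1))))).
  by rewrite ler_wpM2l// ge_min lexx orbT.
by rewrite mulrA ltr_pdivrMr// mulrC ltr_pM2l//; lra.
Qed.

(** Induction on the distance of the coordinates: with [l] next to [i], the rotation of [i, j] is
    the commutator of those of [i, l] and [l, j], and each half of the commutator integrates to
    zero. *)
Lemma sph_int_prot (i j : 'I_n) e : sI (pev (prot i j e)) = 0.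
Proof.
wlog ltij : i j / (i < j)%N.
  move=> W; have [ij|ji|ij] := ltngtP (i : nat) j; first exact: W.
    have -> : pev (prot i j e) = (fun x => - pev (prot j i e) x).
      by apply/funext => x; rewrite !pev_prot opprB.
    by rewrite sph_intN W ?oppr0.
  have -> : pev (prot i j e) = (fun _ => 0).
    by apply/funext => x; rewrite (val_inj ij) pev_prot subrr.
  exact: sph_int_cst.
have [k jk] : {k : nat | nat_of_ord j = (i + k.+1)%N}.
  by exists (j - i.+1)%N; rewrite addnS -addSn subnKC.
elim: k i {ltij} jk e => [|k IH] i jk e.
  by apply: sph_int_prot_adj; rewrite jk addn1.
have i1 : (i.+1 < n)%N.
  by apply: leq_ltn_trans (ltn_ord j); rewrite jk -addn1 leq_add2l.
pose l : 'I_n := Ordinal i1.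
have lj : nat_of_ord j = (l + k.+1)%N by rewrite jk /= addSnnS.
have ne1 : i != l by rewrite neq_ltn /= ltnSn.
have ne (q : 'I_n) r : nat_of_ord j = (q + r.+1)%N -> q != j.
  by move=> jq; apply/eqP => /(congr1 (@nat_of_ord _)); rewrite jq; lia.
have [ne2 ne3] := (ne _ _ lj, ne _ _ jk).
have -> : pev (prot i j e) =
   (fun x => pev (prot i l (prot l j e)) x + - pev (prot l j (prot i l e)) x).
  by apply/funext => x; rewrite -(prot_comm _ _ ne1 ne2 ne3).
rewrite sph_intD; [|exact: bounded_imeas_pev|apply: bounded_imeasN; exact: bounded_imeas_pev].
by rewrite sph_intN IH// sph_int_prot_adj// oppr0 addr0.
Qed.

Lemma sph_int_sum (I : Type) (r : seq I) (F : I -> 'rV[R]_n -> R) :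
  (forall i, bounded_imeas (F i)) ->
  sI (fun x => \sum_(i <- r) F i x) = \sum_(i <- r) sI (F i) /\
  bounded_imeas (fun x => \sum_(i <- r) F i x).
Proof.
move=> bF; elim: r => [|i r [IH bIH]].
  have -> : (fun x => \sum_(i <- [::]) F i x) = (fun _ => 0).
    by apply/funext => x; rewrite big_nil.
  by rewrite big_nil sph_int_cst; split => //; exact: bounded_imeas_cst.
have -> : (fun x => \sum_(j <- i :: r) F j x) =
    (fun x => F i x + \sum_(j <- r) F j x).
  by apply/funext => x; rewrite big_cons.
by rewrite big_cons -IH; split; [exact: sph_intD|exact: bounded_imeasD].
Qed.

Lemma sph_int_protM i j e1 e2 :
  sI (fun x => pev (prot i j e1) x * pev e2 x) =
  - sI (fun x => pev e1 x * pev (prot i j e2) x).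
Proof.
apply/eqP; rewrite -addr_eq0 -sph_intD; last 2 first.
- exact: (bounded_imeas_pev (PM (prot i j e1) e2)).
- exact: (bounded_imeas_pev (PM e1 (prot i j e2))).
rewrite -(sph_int_prot i j (PM e1 e2)); apply/eqP; congr sI.
by apply/funext => x; rewrite pev_protM.
Qed.

Lemma sph_int_pcas_sym e1 e2 :
  sI (fun x => pcas e1 x * pev e2 x) = sI (fun x => pev e1 x * pcas e2 x).
Proof.
have -> : (fun x => pcas e1 x * pev e2 x) =
  (fun x => \sum_(ij : 'I_n * 'I_n)
     pev (PM (prot ij.1 ij.2 (prot ij.1 ij.2 e1)) e2) x).
  by apply/funext => x; rewrite /pcas pair_big mulr_suml.
have -> : (fun x => pev e1 x * pcas e2 x) =
  (fun x => \sum_(ij : 'I_n * 'I_n)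
     pev (PM e1 (prot ij.1 ij.2 (prot ij.1 ij.2 e2))) x).
  by apply/funext => x; rewrite /pcas pair_big mulr_sumr.
rewrite (sph_int_sum _ (fun ij => bounded_imeas_pev _)).1.
rewrite (sph_int_sum _ (fun ij => bounded_imeas_pev _)).1.
apply: eq_bigr => -[i j] _.
apply: (etrans (sph_int_protM i j (prot i j e1) e2)).
by rewrite sph_int_protM opprK.
Qed.

End rotation_invariance.

(** * The zonal power kernel and its eigenvalues *)

Section power_kernel.
Variables (R : realType) (d : nat).
Local Notation n := d.+1.
Local Notation sI := (sph_int R d).
Implicit Types (e : pexp R n) (x y : 'rV[R]_n).

Definition dot x y : R := \sum_(i < n) x ord0 i * y ord0 i.

Lemma sph_int_pevD e1 e2 : sI (pev (PD e1 e2)) = sI (pev e1) + sI (pev e2).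
Proof. by rewrite -sph_intD//; exact: bounded_imeas_pev. Qed.

Lemma sph_int_pevZ (a : R) e : sI (pev (PM (PC a) e)) = a * sI (pev e).
Proof. by rewrite -sph_intZ//; exact: bounded_imeas_pev. Qed.

Lemma sph_int_psub e1 e2 : sI (pev (psub e1 e2)) = sI (pev e1) - sI (pev e2).
Proof. by rewrite sph_int_pevD sph_int_pevZ mulN1r. Qed.

Lemma eq_sph_int_pev e1 e2 : (forall x, sphere R d x -> pev e1 x = pev e2 x) ->
  sI (pev e1) = sI (pev e2).
Proof. by apply: eq_sph_int; exact: bounded_imeas_pev. Qed.

Lemma sph_int_norm_le e1 e2 : (forall x, sphere R d x -> `|pev e1 x| <= pev e2 x) ->
  `|sI (pev e1)| <= sI (pev e2).
Proof.
move=> h; rewrite ler_norml -subr_ge0 opprK -[X in _ && X]subr_ge0 -sph_int_pevD -sph_int_psub.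
apply/andP; split; apply: sph_int_ge0; try exact: bounded_imeas_pev.
  by move=> x /h; rewrite ler_norml -subr_ge0 opprK => /andP[].
by move=> x /h; rewrite ler_norml => /andP[_]; rewrite pev_psub subr_ge0.
Qed.

Definition pker x (L : nat) : pexp R n :=
  pexpn (PM (PC 2^-1) (PD (PC 1)
    (psum (index_enum 'I_n) (fun i => PM (PC (x ord0 i)) (PX i))))) L.

Definition halfdot x y : R := (1 + dot x y) / 2.

Lemma pev_pker x L y : pev (pker x L) y = halfdot x y ^+ L.
Proof.
by rewrite pev_pexpn /= pev_psum /halfdot mulrC.
Qed.

Lemma pev_pder_pker x L i y : pev (pder i (pker x L)) y =
  pev (PM (PC (L%:R / 2 * x ord0 i)) (pker x L.-1)) y.
Proof.
have dsum : pev (pder i (psum (index_enum 'I_n)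
    (fun i => PM (PC (x ord0 i)) (PX i)))) y = x ord0 i.
  rewrite pder_psum pev_psum (bigD1 i)//= eqxx big1 => [|j /negPf ji] /=.
    by rewrite /=; ring.
  by rewrite eq_sym ji /=; ring.
rewrite pev_pder_pexpn [in LHS]/= dsum /= -/(pker x L.-1) pev_pexpn /=.
by field.
Qed.

Definition mu (l : nat) : R := (l * (l + d - 1))%:R.

Lemma muS l : mu l.+1 = (l.+1)%:R * (l + d)%:R.
Proof. by rewrite /mu addSn subn1 /= natrM. Qed.

(** Coefficient of [halfdot ^+ l] in the image of [halfdot ^+ l.+1] under the Laplace-Beltrami
    operator. *)
Definition kappa (l : nat) : R := (l.+1)%:R * (l.*2 + d)%:R / 2.

Lemma pcas_pker x y L : sqnorm R n x = 1 -> sqnorm R n y = 1 ->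
  pcas (pker x L.+1) y =
  2 * (kappa L * pev (pker x L) y - mu L.+1 * pev (pker x L.+1) y).
Proof.
move=> x1 y1; rewrite pcasE y1 mul1r.
have eul : peuler (pker x L.+1) y = L.+1%:R / 2 * dot x y * halfdot x y ^+ L.
  rewrite /peuler /dot mulrAC mulr_sumr; apply: eq_bigr => i _.
  by rewrite pev_pder_pker /= pev_pker; ring.
have snd i j : pev (pder i (pder j (pker x L.+1))) y =
    L.+1%:R / 2 * (L%:R / 2) * halfdot x y ^+ L.-1 * (x ord0 i * x ord0 j).
  rewrite (eq_pev_pder (funext (pev_pder_pker x L.+1 j))) /=.
  by rewrite mul0r add0r pev_pder_pker /= pev_pker; ring.
have lap : plap (pker x L.+1) y = L.+1%:R / 2 * (L%:R / 2) * halfdot x y ^+ L.-1.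
  rewrite /plap; under eq_bigr => i _ do rewrite snd.
  by rewrite -mulr_sumr; under eq_bigr => i _ do rewrite -expr2; rewrite [X in _ * X]x1 mulr1.
have hess : phess (pker x L.+1) y =
    L.+1%:R / 2 * (L%:R / 2) * halfdot x y ^+ L.-1 * dot x y ^+ 2.
  rewrite /phess expr2 {2}/dot mulr_suml mulr_sumr; apply: eq_bigr => i _.
  rewrite /dot !mulr_sumr; apply: eq_bigr => j _.
  by rewrite snd; ring.
rewrite eul lap hess !pev_pker /kappa muS.
have -> : dot x y = 2 * halfdot x y - 1 by rewrite /halfdot; field.
rewrite -muln2 !natrD !natrM -!natr1.
(* For [L = 0] the exponent [L.-1] is truncated, but the second derivatives carry a factor [L]. *)
case: L {eul snd lap hess} => [|L] /=; first by rewrite expr0 expr1; field.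
by rewrite !exprS -!natr1; field.
Qed.

Lemma bounded_imeas_pcas e : bounded_imeas (pcas e).
Proof.
have -> : pcas e = (fun x => \sum_(ij : 'I_n * 'I_n)
     pev (prot ij.1 ij.2 (prot ij.1 ij.2 e)) x).
  by apply/funext => x; rewrite /pcas pair_big.
exact: (sph_int_sum _ (fun ij => bounded_imeas_pev _)).2.
Qed.

Definition kT (L : nat) e x : R := sI (pev (PM (pker x L) e)).

Definition harmonic_pexp (l : nat) e := forall x, pcas e x = - 2 * mu l * pev e x.

Lemma kT_rec l L e x : harmonic_pexp l e -> sphere R d x ->
  (mu L.+1 - mu l) * kT L.+1 e x = kappa L * kT L e x.
Proof.
move=> el xS.
have := sph_int_pcas_sym (pker x L.+1) e.
have -> : sI (fun y => pev (pker x L.+1) y * pcas e y) = - 2 * mu l * kT L.+1 e x.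
  rewrite /kT -sph_int_pevZ.
  by congr sI; apply/funext => y; rewrite el /=; ring.
have -> : sI (fun y => pcas (pker x L.+1) y * pev e y) =
    2 * (kappa L * kT L e x - mu L.+1 * kT L.+1 e x).
  have -> : 2 * (kappa L * kT L e x - mu L.+1 * kT L.+1 e x) =
    sI (pev (PM (PC 2) (psub (PM (PC (kappa L)) (PM (pker x L) e))
                             (PM (PC (mu L.+1)) (PM (pker x L.+1) e))))).
    by rewrite sph_int_pevZ sph_int_psub !sph_int_pevZ.
  apply: eq_sph_int.
  - by apply: bounded_imeasM; [exact: bounded_imeas_pcas|exact: bounded_imeas_pev].
  - exact: bounded_imeas_pev.
  - by move=> y yS; rewrite pcas_pker//=; ring.
move=> h; lra.
Qed.

(** Each factor is [kappa k / mu k.+1], as [kT_rec] dictates in degree 0; [kT1] identifies the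
    product with the integral of the kernel. *)
Definition m0 (L : nat) : R := \prod_(k < L) ((k.*2 + d)%:R / (2 * (k + d)%:R)).

Hypothesis d_gt0 : (0 < d)%N.

Lemma m0S L : m0 L.+1 = m0 L * ((L.*2 + d)%:R / (2 * (L + d)%:R)).
Proof. by rewrite /m0 big_ord_recr. Qed.

Let kd_neq0 k : (k + d)%:R != 0 :> R.
Proof. by rewrite pnatr_eq0 addn_eq0 negb_and orbC -lt0n d_gt0. Qed.

Lemma m0_gt0 L : 0 < m0 L.
Proof.
apply: prodr_gt0 => k _; rewrite divr_gt0 ?mulr_gt0 ?ltr0n//.
  by rewrite addn_gt0 d_gt0 orbT.
by rewrite addn_gt0 d_gt0 orbT.
Qed.

Lemma muS_gt0 L : 0 < mu L.+1.
Proof. by rewrite muS mulr_gt0 ?ltr0n// addn_gt0 d_gt0 orbT. Qed.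

Lemma mu_ge0 L : 0 <= mu L. Proof. exact: ler0n. Qed.

Lemma mu_m0 L : mu L.+1 * m0 L.+1 = kappa L * m0 L.
Proof. by rewrite muS m0S /kappa; field; rewrite -natrD kd_neq0. Qed.

Lemma kT_ratio l L e x : harmonic_pexp l e -> sphere R d x ->
  kT L e x / m0 L = (1 - mu l / mu L.+1) * (kT L.+1 e x / m0 L.+1).
Proof.
move=> el xS.
have h1 : m0 L != 0 by rewrite gt_eqF ?m0_gt0.
have h2 : m0 L.+1 != 0 by rewrite gt_eqF ?m0_gt0.
have h3 : mu L.+1 != 0 by rewrite gt_eqF ?muS_gt0.
have h4 : kappa L != 0.
  by rewrite gt_eqF// /kappa divr_gt0// mulr_gt0 ?ltr0n// addn_gt0 d_gt0 orbT.
apply: (mulfI (mulf_neq0 h4 h1)).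
rewrite -{2}mu_m0 (_ : _ * (_ / _) = kappa L * kT L e x); last by field.
by rewrite -(kT_rec _ el xS); move: (mu L.+1) h3 => M h3; field; rewrite h3 h2.
Qed.

Lemma kT1 L x : sphere R d x -> kT L (PC 1) x = m0 L.
Proof.
move=> xS.
have har : harmonic_pexp 0 (PC 1 : pexp R n).
  move=> y; rewrite /mu mul0n mulr0 mul0r pcasE /plap /phess /peuler.
  rewrite !big1 ?mulr0 ?subr0 ?mulr0// => i _; first by rewrite mulr0.
  by rewrite big1// => j _; rewrite mulr0.
elim: L => [|L IH].
  rewrite /m0 big_ord0 /kT; have := sph_int_cst d (1 : R); congr (_ = _).
  by congr sI; apply/funext => y /=; rewrite mulr1.
have := kT_ratio L har xS.
rewrite IH /mu mul0n mul0r subr0 mul1r divff ?gt_eqF ?m0_gt0// => h.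
have m00 : m0 L.+1 != 0 by rewrite gt_eqF ?m0_gt0.
by rewrite -(divfK m00 (kT L.+1 (PC 1) x)) -h mul1r.
Qed.

Lemma sqnormB1 x y : sqnorm R n x = 1 -> sqnorm R n y = 1 ->
  \sum_(i < n) (y ord0 i - x ord0 i) ^+ 2 = 4 * (1 - halfdot x y).
Proof.
move=> x1 y1.
have -> : \sum_(i < n) (y ord0 i - x ord0 i) ^+ 2 =
    sqnorm R n x + sqnorm R n y - 2 * dot x y.
  rewrite /sqnorm /dot mulr_sumr -big_split -sumrB; apply: eq_bigr => i _ /=.
  by ring.
by rewrite x1 y1 /halfdot; field.
Qed.

Lemma halfdot_le1 x y : sqnorm R n x = 1 -> sqnorm R n y = 1 ->
  0 <= halfdot x y <= 1.
Proof.
move=> x1 y1; apply/andP; split; last first.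
  rewrite -subr_ge0 -(pmulr_rge0 _ (x := 4))// -sqnormB1//.
  by apply: sumr_ge0 => i _; exact: sqr_ge0.
rewrite -(pmulr_rge0 _ (x := 4))//.
have -> : 4 * halfdot x y = \sum_(i < n) (y ord0 i + x ord0 i) ^+ 2.
  transitivity (sqnorm R n x + sqnorm R n y + 2 * dot x y).
    by rewrite x1 y1 /halfdot; field.
  rewrite /sqnorm /dot mulr_sumr -!big_split; apply: eq_bigr => i _ /=.
  by ring.
by apply: sumr_ge0 => i _; exact: sqr_ge0.
Qed.

(** Lipschitz continuity in squared form, since [4 * (1 - halfdot x y)] is the squared distance. The
    factor [1 - halfdot] is also what separates two consecutive kernels. *)
Lemma pev_lipschitz e : exists2 C : R, 0 <= C & forall x y,
  sphere R d x -> sphere R d y ->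
  (pev e y - pev e x) ^+ 2 <= C * (1 - halfdot x y).
Proof.
have sqD (a b : R) : (a + b) ^+ 2 <= 2 * a ^+ 2 + 2 * b ^+ 2.
  by rewrite -subr_ge0 (_ : _ - _ = (a - b) ^+ 2) ?sqr_ge0//; ring.
elim: e => [c|i|p [C1 C10 IH1] q [C2 C20 IH2]|p [C1 C10 IH1] q [C2 C20 IH2]].
- by exists 0 => // x y _ _; rewrite /= subrr expr0n mul0r.
- exists 4 => // x y xS yS /=; rewrite -sqnormB1// (bigD1 i)//= lerDl.
  by apply: sumr_ge0 => j _; exact: sqr_ge0.
- exists (2 * C1 + 2 * C2); first by rewrite addr_ge0// mulr_ge0.
  move=> x y xS yS /=.
  rewrite (_ : _ - _ = (pev p y - pev p x) + (pev q y - pev q x)); last by ring.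
  apply: le_trans (sqD _ _) _; rewrite [leRHS]mulrDl -!mulrA.
  by apply: lerD; rewrite ler_pM2l//; [exact: IH1|exact: IH2].
- have [B1 B10 HB1] := pev_bound p; have [B2 B20 HB2] := pev_bound q.
  exists (2 * (C1 * B2 ^+ 2) + 2 * (B1 ^+ 2 * C2)).
    by rewrite addr_ge0// mulr_ge0// mulr_ge0// sqr_ge0.
  move=> x y xS yS /=.
  rewrite (_ : _ - _ = (pev p y - pev p x) * pev q y + pev p x * (pev q y - pev q x));
    last by ring.
  have h := halfdot_le1 xS yS.
  apply: le_trans (sqD _ _) _; rewrite !exprMn.
  rewrite (_ : _ * (1 - halfdot x y) = 2 * (C1 * (1 - halfdot x y) * B2 ^+ 2) +
    2 * (B1 ^+ 2 * (C2 * (1 - halfdot x y)))); last by ring.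
  apply: lerD; rewrite ler_pM2l//.
    rewrite ler_pM ?sqr_ge0 ?IH1//.
    by rewrite -ler_sqrt ?sqr_ge0// !sqrtr_sqr [leRHS]ger0_norm// HB2.
  rewrite ler_pM ?sqr_ge0 ?IH2//.
  by rewrite -ler_sqrt ?sqr_ge0// !sqrtr_sqr [leRHS]ger0_norm// HB1.
Qed.

(* The normalized kernels concentrate at the diagonal, because
   [m0 L.+1 / m0 L] tends to [1]. *)
Lemma kT_approx e : exists2 C : R, 0 <= C & forall (eps : R) x L, 0 < eps ->
  sphere R d x ->
  `|kT L e x / m0 L - pev e x| <= eps + C / (eps * (L + d)%:R).
Proof.
have [C C0 HC] := pev_lipschitz e.
exists (C * d%:R / 8); first by rewrite divr_ge0// mulr_ge0.
move=> eps x L eps0 xS.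
have m00 := m0_gt0 L.
have -> : kT L e x / m0 L - pev e x = (kT L e x - pev e x * m0 L) / m0 L.
  by field; rewrite gt_eqF.
rewrite normrM normfV (gtr0_norm m00) ler_pdivrMr//.
have m0L x' : sphere R d x' -> sI (pev (pker x' L)) = m0 L.
  by move=> xS'; rewrite -(kT1 L xS'); apply: eq_sph_int_pev => y _ /=; rewrite mulr1.
have -> : kT L e x - pev e x * m0 L =
    sI (pev (PM (pker x L) (psub e (PC (pev e x))))).
  rewrite -(kT1 L xS) -sph_int_pevZ -sph_int_psub.
  by apply: eq_sph_int_pev => y _; rewrite pev_psub /= mulN1r; ring.
(* The difference of consecutive kernels integrates to [m0 L * d / (2 * (L + d))]; times
   [C / (4 * eps)], this is the origin of [C * d / 8]. *)
have -> : (eps + C * d%:R / 8 / (eps * (L + d)%:R)) * m0 L =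
    sI (pev (PD (PM (PC eps) (pker x L))
       (PM (PC (C / (4 * eps))) (psub (pker x L) (pker x L.+1))))).
  have m0L1 : sI (pev (pker x L.+1)) = m0 L.+1.
    by rewrite -(kT1 L.+1 xS); apply: eq_sph_int_pev => y _ /=; rewrite mulr1.
  rewrite sph_int_pevD !sph_int_pevZ sph_int_psub m0L// m0L1 m0S -muln2 !natrD natrM.
  by field; rewrite -natrD kd_neq0 gt_eqF.
apply: sph_int_norm_le => y yS.
have /andP[w0 w1] := halfdot_le1 xS yS.
have -> : pev (PD (PM (PC eps) (pker x L))
       (PM (PC (C / (4 * eps))) (psub (pker x L) (pker x L.+1)))) y =
   halfdot x y ^+ L * (eps + C / (4 * eps) * (1 - halfdot x y)).
  rewrite -[LHS]/(eps * pev (pker x L) y + C / (4 * eps) *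
    pev (psub (pker x L) (pker x L.+1)) y).
  by rewrite pev_psub !pev_pker exprS; ring.
have -> : pev (PM (pker x L) (psub e (PC (pev e x)))) y =
   halfdot x y ^+ L * (pev e y - pev e x).
  by rewrite -pev_pker /= mulN1r.
rewrite normrM ger0_norm ?exprn_ge0// ler_wpM2l ?exprn_ge0//.
set t := pev e y - pev e x.
have : t ^+ 2 <= C * (1 - halfdot x y) by exact: HC.
set w := C * _ => tw.
rewrite (_ : C / (4 * eps) * (1 - halfdot x y) = w / (4 * eps)); last by rewrite /w; ring.
(* This is [|t| <= eps + t ^+ 2 / (4 * eps)], a completed square. *)
rewrite -lerBlDl ler_pdivlMr ?mulr_gt0//; apply: le_trans tw.
rewrite -subr_ge0 -real_normK ?num_real//.
by rewrite (_ : _ - _ = (`|t| - 2 * eps) ^+ 2) ?sqr_ge0//; ring.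
Qed.

End power_kernel.

(** * Eigenvalues as infinite products *)

Section kernel_eigenvalues.
Variables (R : realType) (d : nat).
Hypothesis d_gt0 : (0 < d)%N.
Local Notation n := d.+1.
Local Notation mu := (mu R d).
Local Notation m0 := (m0 R d).

Lemma ler_mu a b : (a <= b)%N -> mu a <= mu b.
Proof. by move=> ab; rewrite ler_nat leq_mul// leq_sub2r// leq_add2r. Qed.

Let rprod l L j : R := \prod_(k < j) (1 - mu l / mu (L + k).+1).

Let rprodS l L j : rprod l L j.+1 = rprod l L j * (1 - mu l / mu (L + j).+1).
Proof. by rewrite /rprod big_ord_recr. Qed.

Let kT_rprod l L j e (x : 'rV[R]_n) : harmonic_pexp l e -> sphere R d x ->
  kT L e x / m0 L = rprod l L j * (kT (L + j) e x / m0 (L + j)).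
Proof.
move=> el xS; elim: j => [|j ->]; first by rewrite /rprod big_ord0 addn0 mul1r.
by rewrite rprodS addnS -[RHS]mulrA -(kT_ratio d_gt0 (L + j) el xS).
Qed.

Let factor_ge0 l L : (l <= L)%N -> 0 <= 1 - mu l / mu L.+1 <= 1.
Proof.
move=> lL; rewrite subr_ge0 gerBl ler_pdivrMr ?mul1r ?muS_gt0//.
by rewrite ler_mu ?leqW//= divr_ge0// ltW// muS_gt0.
Qed.

Let rprod_ge0 l L j : (l <= L)%N -> 0 <= rprod l L j.
Proof.
move=> lL; apply: prodr_ge0 => k _.
by have /andP[] := factor_ge0 (leq_trans lL (leq_addr k L)).
Qed.

(** Each factor is at most [exp(- mu l / mu k.+1)], and [mu k.+1 = (k + 1) * (k + d) <= (k + d) * (k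
    + d + 1)] makes the exponents dominate a telescoping sum. *)
Let rprod_le l L j : (l <= L)%N ->
  rprod l L j <= expR (- mu l * ((L + d)%:R^-1 - (L + j + d)%:R^-1)).
Proof.
move=> lL; elim: j => [|j IH].
  by rewrite /rprod big_ord0 addn0 subrr mulr0 expR0.
rewrite rprodS.
apply: (@le_trans _ _ (expR (- mu l * ((L + d)%:R^-1 - (L + j + d)%:R^-1)) *
                       expR (- (mu l / mu (L + j).+1)))).
  apply: ler_pM => //; first exact: rprod_ge0.
    by have /andP[] := factor_ge0 (leq_trans lL (leq_addr j L)).
  exact: expR_ge1Dx.
rewrite -expRD ler_expR.
rewrite (_ : - mu l * _ + _ =
   - (mu l * ((L + d)%:R^-1 - (L + j + d)%:R^-1 + (mu (L + j).+1)^-1))); last by ring.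
rewrite mulNr lerN2 ler_wpM2l ?mu_ge0// -addrA lerD2l.
rewrite addnS addSn.
have h0 : 0 < (L + j + d)%:R :> R by rewrite ltr0n; lia.
rewrite muS -natr1.
set t := (L + j + d)%:R in h0 *.
have s0 : 0 < (L + j).+1%:R :> R by [].
have st : (L + j).+1%:R <= t by rewrite ler_nat; lia.
set s := (L + j).+1%:R in s0 st *.
have -> : - (t + 1)^-1 = - t^-1 + (t * (t + 1))^-1.
  by field; rewrite !gt_eqF//; lra.
rewrite lerD2l lef_pV2 ?posrE ?mulr_gt0//; last lra.
by rewrite [leRHS]mulrC ler_pM2r//; lra.
Qed.

Lemma cvg_kT e (x : 'rV[R]_n) L : sphere R d x ->
  (fun j => kT (L + j) e x / m0 (L + j)) @ \oo --> pev e x.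
Proof.
move=> xS; have [C C0 HC] := kT_approx d_gt0 e.
apply/cvgrPdist_le => eps eps0; near=> j; rewrite distrC.
apply: (le_trans (HC (eps / 2) x (L + j)%N _ xS)); first by rewrite divr_gt0.
rewrite [leRHS](splitr eps) lerD2l ler_pdivrMr; last first.
  by rewrite mulr_gt0 ?divr_gt0// ltr0n; lia.
rewrite mulrA -ler_pdivrMl ?mulr_gt0 ?divr_gt0//.
apply: (@le_trans _ _ j%:R); last by rewrite ler_nat; lia.
by near: j; exact: nbhs_infty_ger.
Unshelve. all: by end_near. Qed.

(* The eigenvalue of the zonal kernel [halfdot ^+ L] on harmonics of degree [l],
   relative to its value [m0 L] on constants. *)
Lemma kT_eigenvalue l L : exists r : R,
  0 <= r <= expR (- mu l / (2 * (L + d)%:R)) /\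
  forall e (x : 'rV[R]_n), harmonic_pexp l e -> sphere R d x ->
    kT L e x = m0 L * r * pev e x.
Proof.
have m00 : m0 L != 0 by rewrite gt_eqF ?m0_gt0.
have [lL|Ll] := leqP l L; last first.
  (* A polynomial of degree [L] has no component of degree [l > L]: the product contains a factor
     with [mu l / mu l = 1], which vanishes. *)
  exists 0; split; first by rewrite lexx expR_ge0.
  move=> e x el xS; rewrite mulr0 mul0r.
  have := kT_rprod L (l - L) el xS.
  have -> : (l - L = (l - L.+1).+1)%N by lia.
  rewrite rprodS (_ : (L + (l - L.+1)).+1 = l)%N; last by lia.
  rewrite divff; last by rewrite gt_eqF//; case: l Ll {el} => // l _; exact: muS_gt0.
  rewrite subrr mulr0 mul0r => /eqP.
  by rewrite mulf_eq0 invr_eq0 (negPf m00) orbF => /eqP.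
have noninc : {homo rprod l L : a b / (a <= b)%N >-> b <= a}.
  apply/nonincreasing_seqP => j; rewrite rprodS ler_piMr ?rprod_ge0//.
  by have /andP[] := factor_ge0 (leq_trans lL (leq_addr j L)).
have cv : cvgn (rprod l L).
  apply: nonincreasing_is_cvgn => //; exists 0 => _ [j _ <-]; exact: rprod_ge0.
exists (limn (rprod l L)); split.
  apply/andP; split.
    by apply: limr_ge => //; apply: nearW => j; exact: rprod_ge0.
  (* Stopping after [L + d] factors doubles [L + d], so the telescoped difference is
     [1 / (2 * (L + d))]. *)
  apply: (@le_trans _ _ (rprod l L (L + d))).
    exact: nonincreasing_cvgn_ge.
  apply: le_trans (rprod_le _ lL) _; rewrite ler_expR mulNr [leRHS]mulNr lerN2.
  rewrite ler_wpM2l ?mu_ge0//.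
  have -> : (L + (L + d) + d)%:R = 2 * (L + d)%:R :> R.
    by rewrite -natrM; congr _%:R; lia.
  have t0 : (L + d)%:R != 0 :> R by rewrite pnatr_eq0; lia.
  by move: ((L + d)%:R : R) t0 => t t0; rewrite le_eqVlt; apply/orP; left; apply/eqP; field.
move=> e x el xS.
(* By [kT_rprod] this sequence is constant in [j], so its limit is also its value. *)
have : (fun j => rprod l L j * (kT (L + j) e x / m0 (L + j))) @ \oo -->
    limn (rprod l L) * pev e x.
  by apply: cvgM => //; exact: cvg_kT.
under [X in X @ _ --> _]eq_fun => j do rewrite -(kT_rprod L j el xS).
move=> /(cvg_lim (@Rhausdorff R)); rewrite lim_cst; last exact: Rhausdorff.
move=> h; rewrite -mulrA -h; by field.
Qed.

End kernel_eigenvalues.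

(** * Vybiral's inequality *)

Section vybiral.
Variable R : realType.

Definition bil n (G : 'I_n -> 'I_n -> R) (v w : 'I_n -> R) : R :=
  \sum_(i < n) \sum_(j < n) v i * w j * G i j.

Definition psd n (G : 'I_n -> 'I_n -> R) : Prop :=
  (forall i j, G i j = G j i) /\ forall v, 0 <= bil G v v.

Lemma bilDl n (G : 'I_n -> 'I_n -> R) u v w :
  bil G (fun i => u i + v i) w = bil G u w + bil G v w.
Proof.
rewrite /bil -big_split; apply: eq_bigr => i _; rewrite -big_split.
by apply: eq_bigr => j _ /=; ring.
Qed.

Lemma bilDr n (G : 'I_n -> 'I_n -> R) u v w :
  bil G w (fun i => u i + v i) = bil G w u + bil G w v.
Proof.
rewrite /bil -big_split; apply: eq_bigr => i _; rewrite -big_split.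
by apply: eq_bigr => j _ /=; ring.
Qed.

Lemma bil_delta n (G : 'I_n -> 'I_n -> R) (a b : R) k l :
  bil G (fun i => a * (i == k)%:R) (fun i => b * (i == l)%:R) = a * b * G k l.
Proof.
rewrite /bil (bigD1 k)//= (bigD1 l)//= !eqxx !big1 ?addr0 /=.
- by ring.
- by move=> i /negPf ik; rewrite big1// => j _; rewrite ik /=; ring.
- by move=> j /negPf jl; rewrite jl /=; ring.
Qed.

Lemma psd_diag n (G : 'I_n -> 'I_n -> R) i : psd G -> 0 <= G i i.
Proof.
move=> [_ /(_ (fun k => 1 * (k == i)%:R))]; by rewrite bil_delta !mul1r.
Qed.

(** With [G i i = 0], the form on the vector with entries [t] at [i] and [1] at [j] is affine in
    [t]; being nonnegative, it has slope zero. *)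
Lemma psd_diag0 n (G : 'I_n -> 'I_n -> R) i j : psd G -> G i i = 0 -> G i j = 0.
Proof.
move=> [Gs Gp] Gi.
have key (t : R) : 0 <= 2 * t * G i j + G j j.
  have := Gp (fun k => t * (k == i)%:R + 1 * (k == j)%:R).
  by rewrite bilDl !bilDr !bil_delta Gi (Gs j i); congr (_ <= _); ring.
apply/eqP/negPn/negP => Gij.
have := key (- (G j j + 1) / (2 * G i j)).
by rewrite (_ : 2 * _ * _ = - (G j j + 1)); [lra|field].
Qed.

(* Splitting off the rank-one part [q q^T] carrying the first row of [G] leaves
   a positive semidefinite matrix whose first row vanishes. *)
Lemma psd_sqr_ge n (G : 'I_n -> 'I_n -> R) (c : 'I_n -> R) : psd G ->
  (\sum_(i < n) c i * G i i) ^+ 2 <= n%:R * bil (fun i j => G i j ^+ 2) c c.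
Proof.
elim: n G c => [|n IH] G c Gpsd; first by rewrite /bil !big_ord0 expr0n mul0r.
have [Gs Gp] := Gpsd.
have p0 := psd_diag ord0 Gpsd; set p := G ord0 ord0 in p0.
(* If [p = 0], division by zero gives [q = 0], and the first row of [G] already vanishes by
   [psd_diag0]. *)
pose q i := G i ord0 / Num.sqrt p.
have sp2 : Num.sqrt p ^+ 2 = p by exact: sqr_sqrtr.
have sp0 : p != 0 -> Num.sqrt p != 0 by rewrite sqrtr_eq0 -ltNge lt_neqAle eq_sym p0 => ->.
pose H i j := G i j - q i * q j.
have Hs i j : H i j = H j i by rewrite /H Gs mulrC.
have H0 j : H ord0 j = 0.
  have [pz|pn0] := eqVneq p 0.
    by rewrite /H (psd_diag0 _ Gpsd pz) /q -/p pz mul0r mul0r subrr.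
  by rewrite /H /q -/p (Gs j) -{1}sp2; have := sp0 pn0 => s0; field.
have bilH v w : bil H v w = bil G v w - (\sum_i v i * q i) * (\sum_j w j * q j).
  rewrite /bil mulr_suml -sumrB; apply: eq_bigr => i _.
  by rewrite mulr_sumr -sumrB; apply: eq_bigr => j _; rewrite /H; ring.
have Hp v : 0 <= bil H v v.
  have [pz|pn0] := eqVneq p 0.
    rewrite bilH (_ : \sum_i _ = 0) ?mul0r ?subr0//.
    by apply: big1 => i _; rewrite /q pz sqrtr0 invr0 !mulr0.
  (* The first row of [H] is zero, so the entry of [v] at [ord0] is free; this [t] makes the new
     vector orthogonal to [q], where the forms of [H] and [G] agree. *)
  pose t := - (\sum_i v i * q i) / Num.sqrt p.
  pose v' i := v i + t * (i == ord0)%:R.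
  have -> : bil H v v = bil H v' v'.
    rewrite /v' bilDl !bilDr bil_delta H0 mulr0 addr0.
    have z1 : bil H v (fun i => t * (i == ord0)%:R) = 0.
      rewrite /bil big1// => i _; rewrite big1// => j _.
      by have [->|_] := eqVneq j ord0; rewrite ?[H i ord0]Hs ?H0 /=; ring.
    have z2 : bil H (fun i => t * (i == ord0)%:R) v = 0.
      rewrite /bil big1// => i _; rewrite big1// => j _.
      by have [->|_] := eqVneq i ord0; rewrite ?H0 /=; ring.
    by rewrite z1 z2 !addr0.
  rewrite bilH (_ : \sum_i v' i * q i = 0) ?mul0r ?subr0//.
  transitivity (\sum_i v i * q i + t * q ord0).
    rewrite /v'; under eq_bigr => i _ do rewrite mulrDl.
    rewrite big_split/=; congr (_ + _).
    rewrite (bigD1 ord0)//= big1 => [|i /negPf ->]; last by rewrite /=; ring.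
    by rewrite /=; ring.
  have s0 := sp0 pn0.
  have -> : q ord0 = Num.sqrt p by rewrite /q -/p -[X in X / _]sp2; field.
  by rewrite /t divfK// subrr.
pose H' i j := H (lift ord0 i) (lift ord0 j).
pose c' i := c (lift ord0 i).
have bil_lift (K : 'I_n.+1 -> 'I_n.+1 -> R) v :
    (forall j, K ord0 j = 0) -> (forall j, K j ord0 = 0) ->
    bil K v v = bil (fun i j => K (lift ord0 i) (lift ord0 j))
      (fun i => v (lift ord0 i)) (fun i => v (lift ord0 i)).
  move=> K0 K1; rewrite /bil big_ord_recl big1 ?add0r; last by move=> j _; rewrite K0 mulr0.
  by apply: eq_bigr => i _; rewrite big_ord_recl K1 mulr0 add0r.
have H'psd : psd H'.
  split=> [i j|v]; first exact: Hs.
  pose w i := if unlift ord0 i is Some k then v k else 0.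
  have := Hp w; rewrite bil_lift//; last by move=> j; rewrite Hs.
  congr (_ <= _); apply: eq_bigr => i _; apply: eq_bigr => j _.
  by rewrite /w !liftK.
have {IH} := IH H' c' H'psd.
set B := \sum_(i < n) _; set X := bil _ _ _ => BX.
pose A := \sum_i c i * q i ^+ 2.
have -> : \sum_(i < n.+1) c i * G i i = A + B.
  transitivity (A + \sum_(i < n.+1) c i * H i i).
    by rewrite -big_split; apply: eq_bigr => i _; rewrite /= /H; ring.
  by rewrite big_ord_recl H0 mulr0 add0r.
have XE : X = bil (fun i j => H i j ^+ 2) c c.
  by rewrite bil_lift// => j; rewrite ?[H j ord0]Hs H0 expr0n.
(* Entrywise square of [G = H + q q^T]. The mixed term is the form of [H] at [c i * q i], hence
   nonnegative. *)
have GE : bil (fun i j => G i j ^+ 2) c c =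
    X + 2 * bil H (fun i => c i * q i) (fun i => c i * q i) + A ^+ 2.
  rewrite XE /bil expr2 /A mulr_suml mulr_sumr -!big_split; apply: eq_bigr => i _.
  rewrite /= !mulr_sumr -!big_split; apply: eq_bigr => j _ /=.
  by rewrite /H; ring.
have GX : X + A ^+ 2 <= bil (fun i j => G i j ^+ 2) c c.
  by rewrite GE -addrA lerD2l lerDr mulr_ge0// Hp.
have X0 : 0 <= X.
  have [n0|n0] := posnP n.
    by rewrite /X /bil big1// => i _; exfalso; move: (ltn_ord i); rewrite [X in (_ < X)%N]n0.
  by rewrite -(pmulr_rge0 _ (x := n%:R)) ?ltr0n//; apply: le_trans BX; exact: sqr_ge0.
apply: (@le_trans _ _ (n.+1%:R * (X + A ^+ 2))); last by rewrite ler_wpM2l.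
have nA : 0 <= n%:R * A ^+ 2 :> R by rewrite mulr_ge0// sqr_ge0.
rewrite -natr1.
(* Together with [B ^+ 2 <= n X] this bounds [(A + B) ^+ 2]; it follows from the inequality of
   arithmetic and geometric means. *)
suff h : 2 * A * B <= n%:R * A ^+ 2 + X by lra.
apply: (@le_trans _ _ `|2 * A * B|); first exact: ler_norm.
rewrite -(ler_pXn2r (n := 2))// ?nnegrE ?addr_ge0// real_normK ?num_real//.
apply: (@le_trans _ _ (4 * A ^+ 2 * (n%:R * X))).
  rewrite (_ : (2 * A * B) ^+ 2 = 4 * A ^+ 2 * B ^+ 2); last by ring.
  by rewrite ler_wpM2l// mulr_ge0// sqr_ge0.
rewrite -subr_ge0 (_ : _ - _ = (n%:R * A ^+ 2 - X) ^+ 2) ?sqr_ge0//.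
by ring.
Qed.

End vybiral.

(** * Words as features of the power kernel *)

Section features.
Variables (R : realType) (d : nat).
Local Notation n := d.+1.
Local Notation sI := (sph_int R d).
Implicit Types (e : pexp R n) (x y : 'rV[R]_n).

(* [halfdot x y ^+ L] is, up to the factor [2 ^- L], the sum over all words [w]
   of length [L] of [feat w x * feat w y], where the letters stand for the
   functions [1, x_0, ..., x_d]. *)
Definition letter (a : 'I_n.+1) : pexp R n :=
  if unlift ord0 a is Some i then PX i else PC 1.

Definition feat L (w : {ffun 'I_L -> 'I_n.+1}) : pexp R n :=
  foldr (fun k => PM (letter (w k))) (PC 1) (index_enum 'I_L).

Lemma pev_feat L (w : {ffun 'I_L -> 'I_n.+1}) x :
  pev (feat w) x = \prod_(k < L) pev (letter (w k)) x.
Proof.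
by rewrite /feat; elim: (index_enum _) => [|k r IH] /=; rewrite ?big_nil// big_cons IH.
Qed.

Lemma halfdot_feat L x y : halfdot x y ^+ L =
  2 ^- L * \sum_(w : {ffun 'I_L -> 'I_n.+1}) pev (feat w) x * pev (feat w) y.
Proof.
rewrite /halfdot exprMn mulrC exprVn; congr (_ * _).
transitivity (\prod_(k < L) \sum_(a < n.+1) pev (letter a) x * pev (letter a) y).
  rewrite prodr_const card_ord; congr (_ ^+ _).
  rewrite big_ord_recl {1 2}/letter unlift_none /= mulr1; congr (_ + _).
  by apply: eq_bigr => i _; rewrite /letter liftK.
rewrite bigA_distr_bigA; apply: eq_bigr => w _.
by rewrite !pev_feat -big_split.
Qed.

Lemma sph_int_mulC e1 e2 : sI (pev (PM e1 e2)) = sI (pev (PM e2 e1)).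
Proof.
by congr sI; apply/funext => x; rewrite -[LHS]/(pev e1 x * pev e2 x) mulrC.
Qed.

Lemma sph_int_mul1 e : sI (pev (PM e (PC 1))) = sI (pev e).
Proof. by congr sI; apply/funext => x; exact: mulr1. Qed.

(** Common ground of integration against a fixed polynomial and of quadrature errors; the eigenvalue
    identities are applied to both. *)
Definition sph_functional (phi : pexp R n -> R) : Prop :=
  [/\ forall a e, phi (PM (PC a) e) = a * phi e,
      forall e1 e2, phi (PD e1 e2) = phi e1 + phi e2 &
      forall e1 e2, (forall x, sphere R d x -> pev e1 x = pev e2 x) ->
        phi e1 = phi e2].

Lemma sph_functional_sum phi (I : Type) (r : seq I) (a : I -> R) (F : I -> pexp R n) :
  sph_functional phi ->
  phi (psum r (fun i => PM (PC (a i)) (F i))) = \sum_(i <- r) a i * phi (F i).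
Proof.
move=> [pZ pD pE]; elim: r => [|i r IH] /=; last by rewrite pD pZ IH big_cons.
rewrite big_nil -[RHS](mul0r (phi (PC 0))) -pZ; apply: pE => x _ /=.
by rewrite mulr0.
Qed.

Lemma sph_functional_mul e : sph_functional (fun e' => sI (pev (PM e' e))).
Proof.
split=> [a e1|e1 e2|e1 e2 h].
- by rewrite -sph_int_pevZ; apply: eq_sph_int_pev => x _ /=; rewrite mulrA.
- by rewrite -sph_int_pevD; apply: eq_sph_int_pev => x _ /=; rewrite mulrDl.
- by apply: eq_sph_int_pev => x xS /=; rewrite h.
Qed.

Lemma sph_functional_err N (c : 'I_N -> R) (xs : 'I_N -> 'rV[R]_n) :
  (forall j, sphere R d (xs j)) ->
  sph_functional (fun e => sI (pev e) - \sum_(j < N) c j * pev e (xs j)).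
Proof.
move=> xsS; split=> [a e|e1 e2|e1 e2 h]; cbv beta.
- rewrite sph_int_pevZ [RHS]mulrBr mulr_sumr; congr (_ - _); apply: eq_bigr => j _ /=.
  by rewrite mulrCA.
- rewrite sph_int_pevD; under eq_bigr => j _ do rewrite /= mulrDr.
  by rewrite big_split/=; ring.
- congr (_ - _); first exact: eq_sph_int_pev.
  by apply: eq_bigr => j _; rewrite h.
Qed.

Lemma kT_feat L e x : kT L e x = 2 ^- L *
  \sum_(w : {ffun 'I_L -> 'I_n.+1}) sI (pev (PM (feat w) e)) * pev (feat w) x.
Proof.
rewrite /kT; under [X in _ = _ * X]eq_bigr => w _ do rewrite mulrC.
rewrite -(sph_functional_sum _ _ _ (sph_functional_mul e)) -sph_int_pevZ.
apply: eq_sph_int_pev => y _; rewrite [LHS]/= pev_pker halfdot_feat.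
rewrite [RHS]/= pev_psum mulrA; congr (_ * _ * _).
Qed.

(** Apply [phi] to the eigenvalue equation after expanding the kernel in features. *)
Lemma sum_feat_eigen phi L e b : sph_functional phi ->
  (forall x, sphere R d x -> kT L e x = b * pev e x) ->
  2 ^- L * \sum_(w : {ffun 'I_L -> 'I_n.+1}) phi (feat w) * sI (pev (PM (feat w) e)) =
  b * phi e.
Proof.
move=> phiP ker; have [pZ _ pE] := phiP.
under eq_bigr => w _ do rewrite mulrC.
rewrite -(sph_functional_sum _ _ _ phiP) -!pZ; apply: pE => x xS.
by rewrite [RHS]/= -ker// kT_feat /= pev_psum.
Qed.

Lemma harmonic_orthogonal l l' e e' : (0 < d)%N -> l != l' ->
  harmonic_pexp l e -> harmonic_pexp l' e' -> sI (pev (PM e e')) = 0.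
Proof.
move=> d0 ll' el el'.
have := sph_int_pcas_sym e e'.
have -> : sI (fun x => pcas e x * pev e' x) = - 2 * mu R d l * sI (pev (PM e e')).
  by rewrite -sph_int_pevZ; congr sI; apply/funext => x; rewrite el /= -!mulrA.
have -> : sI (fun x => pev e x * pcas e' x) = - 2 * mu R d l' * sI (pev (PM e e')).
  by rewrite -sph_int_pevZ; congr sI; apply/funext => x; rewrite el' /=; ring.
move=> h; apply/eqP; have : (mu R d l - mu R d l') * sI (pev (PM e e')) == 0.
  by apply/eqP; lra.
rewrite mulf_eq0 subr_eq0 /mu eqr_nat => /orP[/eqP muE|//]; exfalso.
move/eqP: ll'; apply; have h1 (a b : nat) : (a < b)%N ->
    (a * (a + d - 1) < b * (b + d - 1))%N by nia.
by case: (ltngtP l l') => // /h1; rewrite muE ltnn.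
Qed.

End features.

(** * Bessel's inequality in the space of the kernel *)

Section bessel.
Variables (R : realType) (d : nat).
Hypothesis d_gt0 : (0 < d)%N.
Local Notation n := d.+1.
Local Notation sI := (sph_int R d).
Variables (phi : pexp R n -> R) (L : nat).
Hypothesis phiP : sph_functional phi.

(** The kernel with [phi] applied in both variables: the squared dual norm of [phi] on the space of
    the kernel. *)
Definition energy : R :=
  2 ^- L * \sum_(w : {ffun 'I_L -> 'I_n.+1}) phi (feat R w) ^+ 2.

(** Riesz representer of [phi] in the space of the kernel, scaled by [tau]. *)
Definition fooling (tau : R) : pexp R n :=
  psum (index_enum {ffun 'I_L -> 'I_n.+1})
    (fun w => PM (PC (tau * 2 ^- L * phi (feat R w))) (feat R w)).

Lemma phi_fooling tau : phi (fooling tau) = tau * energy.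
Proof.
rewrite sph_functional_sum// /energy mulrA [RHS]mulr_sumr.
by apply: eq_bigr => w _; rewrite expr2 mulrA.
Qed.

Lemma fooling_eigen tau e b :
  (forall x, sphere R d x -> kT L e x = b * pev e x) ->
  sI (pev (PM (fooling tau) e)) = tau * (b * phi e).
Proof.
move=> ker; rewrite (sph_functional_sum _ _ _ (sph_functional_mul e)).
rewrite -(sum_feat_eigen phiP ker) mulrA mulr_sumr.
by apply: eq_bigr => w _; rewrite mulrA.
Qed.

(** The [g l] play the role of the harmonic components of [fooling tau], whose squared kernel norm
    is the right-hand side. With [B] the feature coefficients of their partial sum, the cross term
    and the square of [B] both equal the left-hand side, so expanding a square suffices. *)
Lemma bessel tau N (g : nat -> pexp R n) (b : nat -> R) :
  (forall l, harmonic_pexp l (g l)) ->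
  (forall l x, sphere R d x -> kT L (g l) x = b l * pev (g l) x) ->
  (forall l, sI (pev (PM (g l) (g l))) = tau * (b l * phi (g l))) ->
  \sum_(l < N) (b l)^-1 * sI (pev (PM (g l) (g l))) <= tau ^+ 2 * energy.
Proof.
move=> har ker nrm; set S := \sum_(l < N) _.
(* Division by [b l] inverts the integral operator on each component, so the integrals of [u]
   against the features represent the sum of the [g l]. *)
pose u := psum (index_enum 'I_N) (fun l : 'I_N => PM (PC (b l)^-1) (g l)).
pose W : finType := {ffun 'I_L -> 'I_n.+1}.
pose A (w : W) := phi (feat R w); pose B (w : W) := sI (pev (PM (feat R w) u)).
have BE w : B w = \sum_(l < N) (b l)^-1 * sI (pev (PM (feat R w) (g l))).
  rewrite /B sph_int_mulC (sph_functional_sum _ _ _ (sph_functional_mul _)).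
  by apply: eq_bigr => l _; rewrite sph_int_mulC.
have ip psi : sph_functional psi ->
    2 ^- L * (\sum_(w : W) psi (feat R w) * B w) =
    \sum_(l < N) (b l)^-1 * (b l * psi (g l)).
  move=> psiP; under eq_bigr => w _ do rewrite BE mulr_sumr.
  rewrite exchange_big/= mulr_sumr; apply: eq_bigr => l _.
  rewrite -(sum_feat_eigen psiP (ker l)) mulrCA; congr (_ * _); rewrite mulr_sumr.
  by apply: eq_bigr => w _; rewrite mulrCA.
have AB : tau * (2 ^- L * \sum_(w : W) A w * B w) = S.
  rewrite ip// mulr_sumr; apply: eq_bigr => l _.
  by rewrite nrm mulrCA.
have BB : 2 ^- L * \sum_(w : W) B w * B w = S.
  rewrite (ip _ (sph_functional_mul u)); apply: eq_bigr => l _.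
  have -> : sI (pev (PM (g l) u)) = (b l)^-1 * sI (pev (PM (g l) (g l))).
    rewrite sph_int_mulC (sph_functional_sum _ _ _ (sph_functional_mul _)).
    rewrite (bigD1 l)//= big1 ?addr0// => l' ll'.
    by rewrite (harmonic_orthogonal d_gt0 _ (har l') (har l)) ?mulr0.
  (* When [b l = 0] the convention [0^-1 = 0] annihilates both sides. *)
  have [b0|b0] := eqVneq (b l) 0; first by rewrite b0 invr0 !mul0r.
  by rewrite mulVKf.
have : 0 <= 2 ^- L * \sum_(w : W) (tau * A w - B w) ^+ 2.
  by rewrite mulr_ge0 ?invr_ge0 ?exprn_ge0// sumr_ge0// => w _; exact: sqr_ge0.
have -> : 2 ^- L * \sum_(w : W) (tau * A w - B w) ^+ 2 =
    tau ^+ 2 * energy - 2 * (tau * (2 ^- L * \sum_(w : W) A w * B w)) +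
    2 ^- L * \sum_(w : W) B w * B w.
  rewrite /energy !(mulrCA _ (2 ^- L)) -mulrBr -mulrDr; congr (_ * _).
  rewrite !mulr_sumr -sumrB -big_split; apply: eq_bigr => w _ /=.
  by rewrite -/(A w); ring.
by rewrite AB BB; lra.
Qed.

End bessel.

(** The left-hand side is the minimum of [m - 2 * m * s + s ^+ 2 / N] over the sum [s] of the
    weights, taken at [s = N * m]. *)
Lemma energy_ge (R : realType) d K N (c : 'I_N -> R) (xs : 'I_N -> 'rV[R]_d.+1) :
  (0 < d)%N -> (forall j, sphere R d (xs j)) -> (0 < N)%N ->
  m0 R d (K * 2) - N%:R * m0 R d (K * 2) ^+ 2 <=
  energy (fun e => sph_int R d (pev e) - \sum_(j < N) c j * pev e (xs j)) (K * 2).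
Proof.
move=> d0 xsS N0; set L := (K * 2)%N; set phi := (fun e : pexp R d.+1 => _).
have phiP : sph_functional phi by exact: sph_functional_err.
have phiE e : phi e = sph_int R d (pev e) - \sum_(j < N) c j * pev e (xs j) by [].
set m := m0 R d L; pose s := \sum_(j < N) c j.
have ker1 x : sphere R d x -> kT L (PC 1) x = m * pev (PC 1) x.
  by move=> xS; rewrite kT1 ?mulr1.
pose G i j := halfdot (xs i) (xs j) ^+ K.
have E1 : energy phi L = m * phi (PC 1) -
    \sum_(j < N) c j * (2 ^- L *
       \sum_(w : {ffun 'I_L -> 'I_d.+2}) phi (feat R w) * pev (feat R w) (xs j)).
  rewrite -(sum_feat_eigen phiP ker1) /energy.
  under [X in _ - X]eq_bigr => j _ do rewrite mulrCA.
  rewrite -mulr_sumr -mulrBr; congr (_ * _).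
  under [X in _ - X]eq_bigr => j _ do rewrite mulr_sumr.
  rewrite exchange_big/= -sumrB; apply: eq_bigr => w _.
  rewrite sph_int_mul1 expr2 [X in _ * X]phiE [LHS]mulrBr; congr (_ - _).
  by rewrite mulr_sumr; apply: eq_bigr => j _; rewrite mulrCA.
have E2 j : 2 ^- L * (\sum_(w : {ffun 'I_L -> 'I_d.+2})
    phi (feat R w) * pev (feat R w) (xs j)) = m - \sum_(i < N) c i * G i j ^+ 2.
  have -> : m = 2 ^- L * \sum_(w : {ffun 'I_L -> 'I_d.+2})
      sph_int R d (pev (feat R w)) * pev (feat R w) (xs j).
    rewrite /m -(kT1 d0 L (xsS j)) kT_feat; congr (_ * _).
    by apply: eq_bigr => w _; rewrite sph_int_mul1.
  have -> : \sum_(i < N) c i * G i j ^+ 2 = 2 ^- L * \sum_(w : {ffun 'I_L -> 'I_d.+2})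
      (\sum_(i < N) c i * pev (feat R w) (xs i)) * pev (feat R w) (xs j).
    rewrite mulr_sumr; under [RHS]eq_bigr => w _ do rewrite mulr_suml mulr_sumr.
    rewrite exchange_big/=; apply: eq_bigr => i _.
    rewrite -exprM halfdot_feat mulrCA mulr_sumr mulr_sumr; apply: eq_bigr => w _.
    by ring.
  rewrite -mulrBr -sumrB; congr (_ * _); apply: eq_bigr => w _.
  by rewrite /phi mulrBl.
have phi1 : phi (PC 1) = 1 - s.
  rewrite /phi /s (sph_int_cst d (1 : R)); congr (_ - _).
  by apply: eq_bigr => j _ /=; rewrite mulr1.
have Gpsd : psd G.
  split=> [i j|v].
    by rewrite /G /halfdot /dot; congr (((1 + _) / 2) ^+ K); apply: eq_bigr => k _; rewrite mulrC.
  have -> : bil G v v = 2 ^- K * \sum_(w : {ffun 'I_K -> 'I_d.+2})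
      (\sum_(j < N) v j * pev (feat R w) (xs j)) ^+ 2.
    rewrite /bil mulr_sumr.
    under [RHS]eq_bigr => w _ do rewrite expr2 mulr_suml mulr_sumr.
    rewrite [RHS]exchange_big/=; apply: eq_bigr => i _.
    under [RHS]eq_bigr => w _ do rewrite mulr_sumr mulr_sumr.
    rewrite [RHS]exchange_big/=; apply: eq_bigr => j _.
    rewrite /G halfdot_feat mulrCA mulr_sumr mulr_sumr; apply: eq_bigr => w _.
    by ring.
  by rewrite mulr_ge0 ?invr_ge0 ?exprn_ge0// sumr_ge0// => w _; exact: sqr_ge0.
have G1 i : G i i = 1.
  rewrite /G (_ : halfdot _ _ = 1) ?expr1n// /halfdot.
  have -> : dot (xs i) (xs i) = 1.
    by rewrite -[RHS](xsS i); apply: eq_bigr => k _; rewrite expr2.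
  by field.
have := psd_sqr_ge c Gpsd.
have -> : \sum_(i < N) c i * G i i = s by apply: eq_bigr => i _; rewrite G1 mulr1.
set X := bil _ c c => sX.
have -> : energy phi L = m - 2 * m * s + X.
  rewrite E1 phi1; under eq_bigr => j _ do rewrite E2 mulrBr.
  rewrite sumrB -mulr_suml -/s.
  have -> : \sum_(j < N) c j * (\sum_(i < N) c i * G i j ^+ 2) = X.
    rewrite /X /bil exchange_big; apply: eq_bigr => j _; rewrite mulr_sumr.
    by apply: eq_bigr => i _ /=; ring.
  by ring.
have N0' : 0 < N%:R :> R by rewrite ltr0n.
rewrite -addrA lerD2l -(ler_pM2l N0').
apply: (@le_trans _ _ (N%:R * (- (2 * m * s)) + s ^+ 2)); last by rewrite mulrDr lerD2l.
rewrite -subr_ge0 (_ : _ - _ = (s - N%:R * m) ^+ 2) ?sqr_ge0//.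
by ring.
Qed.

(** * Numerical estimates *)

(** Each factor is [1 - d / (2 * (L + d))], at most [exp(- (d / 2) * ln (1 + 1 / (L + d)))], and
    these logarithms telescope. *)
Lemma m0_le (R : realType) d L : (0 < d)%N ->
  m0 R d L <= expR (- (d%:R / 2) * ln ((L + d)%:R / d%:R)).
Proof.
move=> d0; have d0' : 0 < d%:R :> R by rewrite ltr0n.
elim: L => [|L IH].
  by rewrite /m0 big_ord0 add0n divff ?gt_eqF// ln1 mulr0 expR0.
have t0 : 0 < (L + d)%:R :> R by rewrite ltr0n; lia.
have m0L : 0 < m0 R d L by exact: m0_gt0.
have -> : m0 R d L.+1 = m0 R d L * (1 - d%:R / 2 / (L + d)%:R).
  rewrite m0S -muln2 natrD natrM; congr (_ * _).
  have : (L + d)%:R != 0 :> R by rewrite gt_eqF.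
  by rewrite natrD => h; field.
have -> : ln ((L.+1 + d)%:R / d%:R) =
    ln ((L + d)%:R / d%:R) + ln (1 + (L + d)%:R^-1) :> R.
  rewrite -lnM ?posrE ?divr_gt0 ?addr_gt0 ?invr_gt0//; congr ln.
  rewrite addSn -natr1; move: (L + d)%:R t0 => t t0.
  by field; rewrite !gt_eqF.
rewrite [X in expR X]mulrDr expRD; apply: ler_pM => //.
- exact: ltW.
- rewrite subr_ge0 ler_pdivrMr// mul1r natrD.
  by have : 0 <= L%:R :> R by []; lra.
- apply: le_trans (expR_ge1Dx _) _; rewrite ler_expR mulNr lerN2.
  rewrite ler_wpM2l ?divr_ge0//; apply: le_ln1Dx.
  by apply: lt_trans (ltrN10 R) _; rewrite invr_gt0.
Qed.

Lemma powR_le_expR (R : realType) (s b : R) : 0 < s -> 0 < b ->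
  exists2 A : R, 0 < A & forall u, 0 <= u -> (1 + u) `^ s * expR (- (u / b)) <= A.
Proof.
(* Chosen so that [s * del = 1 / b]: then [ln z <= z] at [z = (1 + u) * del] yields exactly the
   exponent [u / b]. *)
move=> s0 b0; pose del := (s * b)^-1.
have del0 : 0 < del by rewrite invr_gt0 mulr_gt0.
exists (expR (b^-1 - s * ln del)); first exact: expR_gt0.
move=> u u0; have u1 : 0 < 1 + u by rewrite ltr_pwDl.
rewrite /powR gt_eqF// -expRD ler_expR.
have : ln ((1 + u) * del) <= (1 + u) * del.
  by apply/ltW/ln_sublinear; rewrite mulr_gt0.
rewrite lnM ?posrE// => h.
have {}h : s * (ln (1 + u) + ln del) <= s * ((1 + u) * del) by rewrite ler_pM2l.
have E : s * ((1 + u) * del) = b^-1 + u / b.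
  by rewrite /del; field; rewrite !gt_eqF.
rewrite E mulrDr in h; lra.
Qed.

Lemma powR_ler (R : realType) (s a b : R) : 0 <= s -> 0 <= a -> a <= b ->
  a `^ s <= b `^ s.
Proof.
by move=> s0 a0 ab; apply: ge0_ler_powR => //; rewrite nnegrE// (le_trans a0).
Qed.

(** * Sobolev and logarithmic weights against exponential decay *)

Section weight_bound.
Variables (R : realType) (alpha beta kap b y0 : R).
Hypotheses (alpha0 : 0 < alpha) (kap0 : 0 < kap) (b0 : 0 < b) (y00 : 0 < y0).

Let ln3 : 0 < ln (3 : R). Proof. by apply: ln_gt0; lra. Qed.

(* [u] stands for [(1 + t) / W] and [x] for [ln (3 + t)]. *)
Let log_bound : exists2 C : R, 0 < C & forall u x y, 0 < u -> y0 <= y ->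
  ln 3 <= x -> x <= ln 3 + kap * y + ln u -> kap * y <= x - ln u ->
  u `^ alpha * x `^ (2 * beta) * expR (- (u / b)) <= C * y `^ (2 * beta).
Proof.
have [be0|be0] := leP 0 beta.
  (* For [beta >= 0], the bound [x <= D * y * (1 + u)] trades the logarithmic power for a power of
     [1 + u], which the exponential absorbs. *)
  have s0 : 0 < alpha + 2 * beta by rewrite ltr_pwDl// mulr_ge0.
  have [A A0 HA] := powR_le_expR s0 b0.
  pose D := ln 3 / y0 + kap + y0^-1.
  have D0 : 0 < D by rewrite !addr_gt0// ?divr_gt0// invr_gt0.
  exists (A * D `^ (2 * beta)); first by rewrite mulr_gt0// powR_gt0.
  move=> u x y u0 yy0 x3 xle _.
  have y_gt0 : 0 < y by exact: lt_le_trans yy0.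
  have xD : x <= D * y * (1 + u).
    have h1 : ln 3 <= ln 3 / y0 * y by rewrite mulrAC ler_pdivlMr// ler_pM2l.
    have h2 : 1 <= y0^-1 * y by rewrite mulrC ler_pdivlMr// mul1r.
    have h3 : ln u <= u by exact/ltW/ln_sublinear.
    have h4 : u <= y0^-1 * y * u by rewrite ler_peMl//; exact: ltW.
    have h5 : 0 <= (ln 3 / y0 * y + kap * y) * u.
      by rewrite mulr_ge0//; apply: ltW => //; rewrite addr_gt0// mulr_gt0// divr_gt0.
    rewrite /D; have : 0 <= y0^-1 * y by lra.
    lra.
  have x0 : 0 <= x by apply: le_trans x3; exact: ltW.
  have u1 : 0 < 1 + u by lra.
  apply: (@le_trans _ _ ((1 + u) `^ alpha * (D * y * (1 + u)) `^ (2 * beta) *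
      expR (- (u / b)))).
    rewrite ler_wpM2r ?expR_ge0//; apply: ler_pM; rewrite ?powR_ge0//.
      by apply: powR_ler; [exact: ltW|lra|lra].
    by apply: powR_ler => //; rewrite mulr_ge0.
  have [D_ge0 y_ge0 u1_ge0] : [/\ 0 <= D, 0 <= y & 0 <= 1 + u] by split; exact: ltW.
  rewrite powRM ?mulr_ge0// powRM//.
  have -> : (1 + u) `^ alpha * (D `^ (2 * beta) * y `^ (2 * beta) * (1 + u) `^ (2 * beta)) *
      expR (- (u / b)) =
      (1 + u) `^ (alpha + 2 * beta) * expR (- (u / b)) * (D `^ (2 * beta) * y `^ (2 * beta)).
    by rewrite powRD ?[1 + u == 0]gt_eqF ?implybT//; ring.
  rewrite -[leRHS]mulrA ler_wpM2r//; last by apply: HA; exact: ltW.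
  by rewrite mulr_ge0// powR_ge0.
have [B B0 B2] : exists2 B, 0 < B & 2 * beta = - B.
  by exists (- (2 * beta)); [lra|rewrite opprK].
have [A A0 HA] := powR_le_expR alpha0 b0.
(* For [beta < 0], [x] may be much smaller than [y] only if [u] is small. The factor
   [u ^ alpha = (u ^ eps) ^ B] then compensates, because [u ^ eps * |ln u|] stays bounded near 0. *)
have [eps eps0 epsB] : exists2 eps, 0 < eps & eps * B = alpha.
  by exists (alpha / B); [rewrite divr_gt0|rewrite divfK// gt_eqF].
have [K K0 KE] : exists2 K, 0 < K & K = 1 + (eps * ln 3)^-1.
  by eexists; [|reflexivity]; rewrite addr_gt0// invr_gt0 mulr_gt0.
exists (A * (K / kap) `^ B); first by rewrite mulr_gt0// powR_gt0// divr_gt0.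
move=> u x y u0 yy0 x3 _ kle.
have y_gt0 : 0 < y by exact: lt_le_trans yy0.
have x0 : 0 < x by exact: lt_le_trans x3.
have u1 : 0 < 1 + u by lra.
have ue0 : 0 < u `^ eps by exact: powR_gt0.
have yu : y * u `^ eps <= K / kap * x * (1 + u) `^ eps.
  have h1 : - ln u <= (eps * u `^ eps)^-1.
    have : ln (u `^ (- eps)) <= u `^ (- eps) by apply/ltW/ln_sublinear/powR_gt0.
    by rewrite ln_powR powRN invfM mulNr -mulrN -[X in X <= _ -> _]mulrC -ler_pdivlMr// mulrC.
  have h2 : 1 <= x / ln 3 by rewrite ler_pdivlMr// mul1r.
  have h3 : kap * y * u `^ eps <= x * u `^ eps + x / ln 3 / eps.
    apply: (@le_trans _ _ ((x + (eps * u `^ eps)^-1) * u `^ eps)).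
      by rewrite ler_pM2r//; lra.
    rewrite mulrDl lerD2l (_ : _ * _ = 1 / eps); last by field; rewrite !gt_eqF.
    by rewrite ler_pM2r// invr_gt0.
  have h4 : u `^ eps <= (1 + u) `^ eps by apply: powR_ler; lra.
  have h5 : 1 <= (1 + u) `^ eps.
    have := @powR_ler R eps 1 (1 + u); rewrite powR1; apply; lra.
  rewrite (_ : K / kap * x * (1 + u) `^ eps = (K * x * (1 + u) `^ eps) / kap);
    last by field; rewrite gt_eqF.
  rewrite ler_pdivlMr// mulrC mulrA; apply: (le_trans h3).
  rewrite KE mulrDl mul1r [leRHS]mulrDl; apply: lerD.
    by rewrite ler_pM2l.
  rewrite (_ : (eps * ln 3)^-1 * x = x / ln 3 / eps); last by field; rewrite !gt_eqF.
  by rewrite ler_peMr//; apply: ltW; rewrite !divr_gt0.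
rewrite B2 (powRN x B) (powRN y B).
rewrite ler_pdivlMr ?powR_gt0//.
rewrite -(ler_pM2r (powR_gt0 B x0)).
rewrite (_ : _ * _ * _ * _ * _ = u `^ alpha * y `^ B * expR (- (u / b))); last first.
  by field; rewrite gt_eqF// powR_gt0.
have -> : u `^ alpha * y `^ B = (y * u `^ eps) `^ B.
  rewrite powRM; [|exact: ltW|exact: ltW].
  by rewrite -powRrM epsB mulrC.
apply: (@le_trans _ _ ((K / kap * x * (1 + u) `^ eps) `^ B * expR (- (u / b)))).
  apply: ler_wpM2r; first exact: expR_ge0.
  apply: powR_ler.
  - exact: ltW.
  - by apply: mulr_ge0; exact: ltW.
  - exact: yu.
have Kk : 0 < K / kap by exact: divr_gt0.
have [Kk_ge0 x_ge0] : 0 <= K / kap /\ 0 <= x by split; exact: ltW.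
have -> : (K / kap * x * (1 + u) `^ eps) `^ B =
    (K / kap) `^ B * x `^ B * (1 + u) `^ (eps * B).
  rewrite (powRM _ (mulr_ge0 Kk_ge0 x_ge0) (powR_ge0 _ _)).
  by rewrite (powRM _ Kk_ge0 x_ge0) powRrM.
rewrite epsB.
rewrite (_ : _ * _ * _ * _ = (1 + u) `^ alpha * expR (- (u / b)) *
  ((K / kap) `^ B * x `^ B)); last by ring.
rewrite -[leRHS]mulrA ler_wpM2r//; last by apply: HA; exact: ltW.
by rewrite mulr_ge0// powR_ge0.
Qed.

(** Applied with [W = n^(2/d)], [y = ln n] and [t = mu_l]. Since [t = u * W - 1], passing from
    [t / (b * W)] to [u / b] costs at most the factor [exp(1 / b)]. *)
Lemma weight_bound : exists2 C : R, 0 < C & forall W y t, 1 <= W ->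
  ln W = kap * y -> y0 <= y -> 0 <= t ->
  (1 + t) `^ alpha * (ln (3 + t)) `^ (2 * beta) * expR (- (t / (b * W))) <=
  C * (W `^ alpha * y `^ (2 * beta)).
Proof.
have [C C0 HC] := log_bound.
exists (C * expR b^-1); first by rewrite mulr_gt0// expR_gt0.
move=> W y t W1 lnW yy0 t0.
have W0 : 0 < W by lra.
pose u := (1 + t) / W; have u0 : 0 < u by rewrite divr_gt0//; lra.
have tu : 1 + t = u * W by rewrite /u divfK// gt_eqF.
have lnu : ln (1 + t) = ln u + kap * y by rewrite tu lnM ?posrE// lnW.
have h1 : ln 3 <= ln (3 + t) by rewrite ler_ln ?posrE; lra.
have h2 : ln (3 + t) <= ln 3 + kap * y + ln u.
  rewrite (_ : _ + ln u = ln 3 + ln (1 + t)); last by rewrite lnu; ring.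
  rewrite -lnM ?posrE; [|lra|lra].
  by rewrite ler_ln ?posrE; lra.
have h3 : kap * y <= ln (3 + t) - ln u.
  rewrite lerBrDr addrC -lnu ler_ln ?posrE; lra.
have := HC u (ln (3 + t)) y u0 yy0 h1 h2 h3.
rewrite tu (powRM _ (ltW u0) (ltW W0)) => h.
have e1 : expR (- (t / (b * W))) <= expR b^-1 * expR (- (u / b)).
  rewrite -expRD ler_expR (_ : t = u * W - 1); last lra.
  rewrite (_ : - ((u * W - 1) / (b * W)) = (b * W)^-1 - u / b); last first.
    by field; rewrite !gt_eqF.
  by rewrite lerD2r lef_pV2 ?posrE ?mulr_gt0//; apply: ler_peMr => //; exact: ltW.
apply: (@le_trans _ _ (u `^ alpha * W `^ alpha * (ln (3 + t)) `^ (2 * beta) *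
   (expR b^-1 * expR (- (u / b))))).
  by rewrite ler_wpM2l// !mulr_ge0// powR_ge0.
rewrite (_ : _ * _ = W `^ alpha * expR b^-1 *
   (u `^ alpha * ln (3 + t) `^ (2 * beta) * expR (- (u / b)))); last by ring.
rewrite (_ : C * _ * _ = W `^ alpha * expR b^-1 * (C * y `^ (2 * beta))); last by ring.
by rewrite ler_wpM2l// mulr_ge0 ?powR_ge0// expR_ge0.
Qed.

End weight_bound.

(** * The fooling function *)

Lemma harmonic_pexp0 (R : realType) d l : harmonic_pexp l (PC 0 : pexp R d.+1).
Proof.
move=> x; rewrite mulr0 /pcas big1// => i _; rewrite big1// => j _.
by rewrite pev_prot_prot /=; ring.
Qed.

(** Testing the orthogonality of [F - g] against [g] itself gives the norm identity. If no
    projection exists, [projH] takes its default value 0, represented by [PC 0]. *)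
Lemma sph_projection (R : realType) d (F : pexp R d.+1) l : exists g : pexp R d.+1,
  [/\ projH R d l (pev F) = pev g, harmonic_pexp l g &
      sph_int R d (pev (PM g g)) = sph_int R d (pev (PM F g))].
Proof.
rewrite /projH.
have [ex|nex] := pselect (exists g, is_proj R d l (pev F) g); last first.
  exists (PC 0); split.
  - by rewrite xgetPN// => g gP; apply: nex; exists g.
  - by apply: (@harmonic_pexp0 R d l).
  - congr (sph_int R d _); apply/funext => x.
    by rewrite -[LHS]/(0 * 0) -[RHS]/(pev F x * 0) !mulr0.
have := xgetPex (fun _ => 0) ex.
move: (xget _ _) => g [hg /(_ g hg)].
have [e [-> el]] := sph_harmP hg => ort_e.
exists e; split; [by []|exact: el|].
have : sph_int R d (pev (psub (PM F e) (PM e e))) = 0.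
  rewrite -[RHS]ort_e; congr (sph_int R d _); apply/funext => x.
  rewrite pev_psub -[LHS]/(pev F x * pev e x - pev e x * pev e x).
  by rewrite -[RHS]/((pev F x - pev e x) * pev e x) mulrBl.
by rewrite sph_int_psub => /eqP; rewrite subr_eq0 => /eqP.
Qed.

Lemma lam_sqrV (R : realType) d (alpha beta : R) l :
  lam R d alpha beta l ^- 2 =
  (1 + mu R d l) `^ alpha * ln (3 + mu R d l) `^ (2 * beta).
Proof.
have sq (a p : R) : 0 < a -> (a `^ p) ^- 2 = a `^ (- (p * 2)).
  by move=> _; rewrite powRN powRrM (@powR_mulrn R (a `^ p) 2)// powR_ge0.
have m0 := mu_ge0 R d l.
rewrite /lam -/(mu R d l) exprMn invfM !sq; first last.
- lra.
- by apply: ln_gt0; lra.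
by congr (_ `^ _ * _ `^ _); field.
Qed.

(** * Membership of the fooling function in the unit ball *)

Section unit_ball.
Variables (R : realType) (d : nat) (alpha beta : R).
Hypothesis d_gt0 : (0 < d)%N.
Variables (phi : pexp R d.+1 -> R) (L : nat) (C : R).
Hypothesis phiP : sph_functional phi.
Hypothesis C_gt0 : 0 < C.
Hypothesis HC : forall l,
  lam R d alpha beta l ^- 2 * expR (- mu R d l / (2 * (L + d)%:R)) <= C.

(** By [HC] the weight in degree [l] is at most [C / r l = C * m0 / b l], which reduces the norm to
    the sum in [bessel]. *)
Lemma fooling_Hball (tau : R) : tau ^+ 2 * (C * m0 R d L * energy phi L) <= 1 ->
  Hball R d alpha beta (pev (fooling phi L tau)).
Proof.
move=> tau1; split; first by apply: continuous_subspaceT; exact: continuous_pev.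
set F := fooling phi L tau.
have /choice [g gP] := sph_projection F.
have /choice [r rP] : forall l, exists r : R,
    0 <= r <= expR (- mu R d l / (2 * (L + d)%:R)) /\
    forall e (x : 'rV[R]_d.+1), harmonic_pexp l e -> sphere R d x ->
      kT L e x = m0 R d L * r * pev e x by move=> l; exact: kT_eigenvalue.
pose b l := m0 R d L * r l.
have har l : harmonic_pexp l (g l) by have [] := gP l.
have ker l x : sphere R d x -> kT L (g l) x = b l * pev (g l) x.
  by move=> xS; have [_ h] := rP l; exact: h.
have nrm l : sph_int R d (pev (PM (g l) (g l))) = tau * (b l * phi (g l)).
  by have [_ _ ->] := gP l; exact: (fooling_eigen phiP tau (ker l)).
have m00 := m0_gt0 R d_gt0 L.
have nrm0 l : 0 <= sph_int R d (pev (PM (g l) (g l))).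
  apply: sph_int_ge0; first exact: bounded_imeas_pev.
  by move=> x _; rewrite -[X in 0 <= X]/(pev (g l) x * pev (g l) x) -expr2 sqr_ge0.
pose term l : R := lam R d alpha beta l ^- 2 * sph_int R d (pev (PM (g l) (g l))).
have HnormE : Hnorm2 R d alpha beta (pev F) = (\sum_(0 <= l <oo) (term l)%:E)%E.
  rewrite /Hnorm2; congr (limn _); apply/funext => N; apply: eq_bigr => l _.
  by have [-> _ _] := gP l.
have lam0 l : 0 <= lam R d alpha beta l ^- 2 by rewrite invr_ge0 sqr_ge0.
have term0 l : 0 <= term l by rewrite mulr_ge0.
rewrite HnormE; apply: lime_le.
  by apply: is_cvg_nneseries => l _ _; rewrite lee_fin.
apply: nearW => N; rewrite sumEFin lee_fin big_mkord.
apply: le_trans tau1.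
apply: (@le_trans _ _ (\sum_(l < N) C * m0 R d L *
    ((b l)^-1 * sph_int R d (pev (PM (g l) (g l)))))).
  apply: ler_sum => l _; rewrite /term.
  have [/andP[r0 r1] _] := rP l.
  (* A zero eigenvalue forces the component [g l] to have norm zero by [nrm]. *)
  have [rz|rn0] := eqVneq (r l) 0.
    by rewrite nrm /b rz !(mulr0, mul0r).
  have -> : C * m0 R d L * ((b l)^-1 * sph_int R d (pev (PM (g l) (g l)))) =
      C / r l * sph_int R d (pev (PM (g l) (g l))).
    rewrite /b; move: (sph_int R d _) (m0 R d L) m00 (r l) rn0 => I m m_gt0 rl rn0.
    by field; rewrite rn0 gt_eqF.
  apply: ler_wpM2r; first exact: nrm0.
  have r_gt0 : 0 < r l by rewrite lt_neqAle eq_sym rn0.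
  rewrite (ler_pdivlMr _ _ r_gt0); apply: le_trans (HC l).
  by apply: ler_wpM2l; [exact: lam0|].
rewrite -mulr_sumr [leRHS]mulrCA; apply: ler_wpM2l.
  by apply: mulr_ge0; exact: ltW.
exact: (bessel d_gt0 phiP N har ker nrm).
Qed.

End unit_ball.

Theorem theorem1p2 (R : realType) (d : nat) (alpha beta : R) :
  (2 <= d)%N -> d%:R / 2 < alpha ->
  exists c : R, 0 < c /\
    forall n : nat, (2 <= n)%N ->
      ((c * (n%:R `^ (- (alpha / d%:R))) * ((ln (n%:R : R)) `^ (- beta)))%:E
        <= e_n R d alpha beta n)%E.
Proof.
move=> d2 dalpha.
have d_gt0 : (0 < d)%N by lia.
have d0 : 0 < d%:R :> R by rewrite ltr0n.
have alpha0 : 0 < alpha by apply: le_lt_trans dalpha; rewrite divr_ge0.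
pose kap : R := 2 / d%:R.
have kap0 : 0 < kap by rewrite divr_gt0.
(* Sized so that [2 * (L + d) <= b * W] for the [L] chosen below, using [K <= yy + 1] and
   [W >= 1]. *)
pose b : R := 4 * d%:R * 2 `^ kap + 4 + 2 * d%:R.
have b0 : 0 < b by rewrite !addr_gt0// !mulr_gt0// powR_gt0.
have ln2 : 0 < ln (2 : R) by apply: ln_gt0; lra.
have [C C0 HC] := weight_bound beta alpha0 kap0 b0 ln2.
(* The squared error will be at least [1 / (2 * M)] with [M = C * P ^- 2], where [P] is the claimed
   rate. *)
exists (Num.sqrt (2 * C))^-1; split; first by rewrite invr_gt0 sqrtr_gt0 mulr_gt0.
move=> n n2.
have n_gt0 : (0 < n)%N by lia.
have n0 : 0 < n%:R :> R by rewrite ltr0n.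
pose W : R := n%:R `^ kap.
have W1 : 1 <= W.
  have := @powR_ler R kap 1 n%:R; rewrite powR1; apply; first exact: ltW.
    by [].
  by rewrite ler1n.
have lnn : ln 2 <= ln (n%:R : R) by rewrite ler_ln ?posrE// ler_nat.
have lnn0 : 0 < ln (n%:R : R) by exact: lt_le_trans lnn.
pose P : R := n%:R `^ (- (alpha / d%:R)) * ln n%:R `^ (- beta).
have P0 : 0 < P by rewrite mulr_gt0// powR_gt0.
have PE : W `^ alpha * ln n%:R `^ (2 * beta) = P ^- 2.
  rewrite /P exprMn invfM -!powR_invn ?powR_ge0// -!powRrM.
  congr (_ `^ _ * _ `^ _); last by ring.
  by rewrite /kap; field; rewrite gt_eqF.
(* Then [L + d >= yy] makes the quotient in [m0_le] at least [(2 * n)^(2/d)], whence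
   [m0 <= 1 / (2 * n)]. *)
pose yy : R := d%:R * (2 * n%:R) `^ kap.
have yy0 : 0 <= yy by rewrite mulr_ge0// powR_ge0.
have [K K1 K2] : exists2 K : nat, yy < K%:R & K%:R <= yy + 1.
  exists (Num.truncn yy).+1; first exact: truncnS_gt.
  by rewrite -natr1 lerD2r truncn_le.
have [L LE] : exists L, L = (K * 2)%N by exists (K * 2)%N.
have LK : L%:R = 2 * K%:R :> R by rewrite LE natrM mulrC.
have yyW : yy = d%:R * 2 `^ kap * W by rewrite /yy powRM ?mulrA// ltW.
have QbW : 2 * (L + d)%:R <= b * W.
  rewrite natrD LK /b; have : 0 <= (4 + 2 * d%:R) * (W - 1).
    by rewrite mulr_ge0// ?subr_ge0// addr_ge0// mulr_ge0.
  move: K2; rewrite yyW; lra.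
have m00 := m0_gt0 R d_gt0 L.
have Ld0 : 0 < (L + d)%:R :> R by rewrite ltr0n addn_gt0 d_gt0 orbT.
have nm0 : n%:R * m0 R d L <= 2^-1.
  have h1 : kap * ln (2 * n%:R) <= ln ((L + d)%:R / d%:R).
    rewrite -ln_powR ler_ln ?posrE; [|exact/powR_gt0/mulr_gt0|exact: divr_gt0].
    by rewrite (ler_pdivlMr _ _ d0) mulrC -/yy natrD LK; lra.
  have h2 : m0 R d L <= (2 * n%:R)^-1.
    apply: le_trans (m0_le R L d_gt0) _.
    rewrite -[leRHS]lnK ?posrE ?invr_gt0 ?mulr_gt0// ler_expR lnV ?posrE ?mulr_gt0//.
    rewrite mulNr lerN2 -ler_pdivrMl ?divr_gt0//.
    by rewrite invf_div.
  apply: (le_trans (ler_wpM2l (ltW n0) h2)).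
  by rewrite invfM mulrCA divff ?mulr1// gt_eqF.
apply: le_ereal_inf_tmp => _ [[c xs] /= xsS <-].
pose phi e : R := sph_int R d (pev e) - \sum_(j < n) c j * pev e (xs j).
have phiP : sph_functional phi by exact: sph_functional_err.
have En : m0 R d L / 2 <= energy phi L.
  have := energy_ge K c d_gt0 xsS n_gt0; rewrite -LE; apply: le_trans.
  rewrite expr2 mulrA; have := ler_wpM2r (ltW m00) nm0; lra.
have E0 : 0 < energy phi L by apply: lt_le_trans En; rewrite divr_gt0.
have [M M0 ME] : exists2 M, 0 < M & M = C * P ^- 2.
  by eexists; [|reflexivity]; rewrite mulr_gt0// invr_gt0 exprn_gt0.
have HM l : lam R d alpha beta l ^- 2 * expR (- mu R d l / (2 * (L + d)%:R)) <= M.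
  rewrite lam_sqrV ME -PE.
  have := HC W (ln n%:R) (mu R d l) W1 (ln_powR _ _) lnn (mu_ge0 R d l).
  apply: le_trans; rewrite ler_wpM2l ?mulr_ge0 ?powR_ge0// ler_expR mulNr lerN2.
  rewrite ler_wpM2l ?mu_ge0// lef_pV2 ?posrE.
  - exact: QbW.
  - by apply: mulr_gt0 => //; lra.
  - exact: mulr_gt0.
(* Scaled so that the bound required by [fooling_Hball] equals 1. *)
pose tau := (Num.sqrt (M * m0 R d L * energy phi L))^-1.
have T0 : 0 < M * m0 R d L * energy phi L by apply: mulr_gt0 => //; exact: mulr_gt0.
have tau0 : 0 < tau by rewrite invr_gt0 sqrtr_gt0.
have tau2 : tau ^+ 2 = (M * m0 R d L * energy phi L)^-1.
  by rewrite exprVn sqr_sqrtr// ltW.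
have ball := @fooling_Hball R d alpha beta d_gt0 phi L M phiP M0 HM tau.
apply: le_trans (ereal_sup_ubound _); last first.
  exists (pev (fooling phi L tau)); last reflexivity.
  by apply: ball; rewrite tau2 mulVf// gt_eqF.
rewrite lee_fin -/(phi _) (phi_fooling L phiP).
rewrite -mulrA -/P.
have tE0 : 0 <= tau * energy phi L by apply: mulr_ge0; exact: ltW.
rewrite (ger0_norm tE0).
have C20 : 0 < 2 * C by rewrite mulr_gt0.
have cP0 : 0 <= (Num.sqrt (2 * C))^-1 * P.
  by apply: mulr_ge0; [rewrite invr_ge0 sqrtr_ge0|exact: ltW].
rewrite -(ler_pXn2r (n := 2))// ?nnegrE//.
rewrite [leLHS]exprMn [leRHS]exprMn exprVn (sqr_sqrtr (ltW C20)) tau2.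
move: (energy phi L) (m0 R d L) E0 m00 En => E m E0 m00 En.
(* The squared error is [E / (M * m)], and [E >= m / 2] removes [m]. *)
rewrite (_ : (M * m * E)^-1 * E ^+ 2 = E / (M * m)); last first.
  by field; rewrite !gt_eqF.
rewrite (ler_pdivlMr _ _ (mulr_gt0 M0 m00)); apply: le_trans En.
rewrite le_eqVlt; apply/orP; left; apply/eqP; rewrite ME.
by field; rewrite !gt_eqF.
Qed.
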